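(* Let $c\geq 4$ and $v$ be positive integers. A $(4\times c,v)$-near triple array exists if and only if $v\geq c$ and $(c,v)\notin\{(4,9),(5,7),(5,10),(6,8),(7,9),(10,12),(11,13)\}$.
   Context: An $r\times c$ row-column design on $v$ symbols is an array with $r$ rows and $c$ columns in which each cell contains one symbol from a fixed set of $v$ symbols (some symbols may be unused). It is binary if no symbol appears more than once in any row or in any column. Its average replication number is $e=rc/v$; put $e^-=\lfloor e\rfloor$, $e^+=\lceil e\rceil$. It is equireplicate if $e$ is an integer and every symbol occurs exactly $e$ times, and near equireplicate if $e$ is not an integer and every symbol occurs either $e^-$ or $e^+$ times. For a binary design let $\lambda_{rr}$, $\lambda_{cc}$, $\lambda_{rc}$ denote the average number of common symbols between two distinct rows, between two distinct columns, and between a row and a column, respectively, the averages being taken over all such pairs; put $\lambda_{xy}^-=\lfloor\lambda_{xy}\rfloor$, $\lambda_{xy}^+=\lceil\lambda_{xy}\rceil$ for $xy\in\{rr,cc,rc\}$. An $(r\times c,v)$-near triple array, or $(r\times c,v)$-NTA, is a binary $r\times c$ row-column design on $v$ symbols that is equireplicate or near equireplicate and such that any two distinct rows have $\lambda_{rr}^-$ or $\lambda_{rr}^+$ common symbols, any two distinct columns have $\lambda_{cc}^-$ or $\lambda_{cc}^+$ common symbols, and any row and any column have $\lambda_{rc}^-$ or $\lambda_{rc}^+$ common symbols. *)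

(* Defs.v *)
From mathcomp Require Import all_boot all_order all_algebra.

Set Implicit Arguments.
Unset Strict Implicit.
Unset Printing Implicit Defensive.

Import GRing.Theory Num.Theory.
Local Open Scope ring_scope.

Definition row_column_design (r c v : nat) : Type := 'M['I_v]_(r, c).

Definition mean (I : finType) (S : {set I}) (f : I -> nat) : rat :=
  (\sum_(i in S) (f i)%:R) / #|S|%:R.

Definition is_floor_or_ceil (n : nat) (x : rat) : Prop :=
  n%:Z = Num.floor x \/ n%:Z = Num.ceil x.

(* Unordered pairs {i, j} of distinct indices, represented with i < j. *)
Definition distinct_pairs (n : nat) : {set 'I_n * 'I_n} :=
  [set p : 'I_n * 'I_n | (p.1 < p.2)%N].

Section Design.
Variables r c v : nat.
Implicit Type A : row_column_design r c v.

Definition binary A : Prop :=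
  (forall i : 'I_r, injective (fun j : 'I_c => A i j)) /\
  (forall j : 'I_c, injective (fun i : 'I_r => A i j)).

Definition replication A (s : 'I_v) : nat :=
  #|[set p : 'I_r * 'I_c | A p.1 p.2 == s]|.

Definition avg_replication : rat := (r * c)%N%:R / v%:R.

Definition equireplicate A : Prop :=
  avg_replication \is a Num.int /\
  forall s, (replication A s)%:R = avg_replication.

Definition near_equireplicate A : Prop :=
  avg_replication \isn't a Num.int /\
  forall s, is_floor_or_ceil (replication A s) avg_replication.

Definition row_symbols A (i : 'I_r) : {set 'I_v} := [set A i j | j : 'I_c].
Definition col_symbols A (j : 'I_c) : {set 'I_v} := [set A i j | i : 'I_r].

Definition common_rr A (i i' : 'I_r) : nat :=
  #|row_symbols A i :&: row_symbols A i'|.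
Definition common_cc A (j j' : 'I_c) : nat :=
  #|col_symbols A j :&: col_symbols A j'|.
Definition common_rc A (i : 'I_r) (j : 'I_c) : nat :=
  #|row_symbols A i :&: col_symbols A j|.

Definition lambda_rr A : rat :=
  mean (distinct_pairs r) (fun p => common_rr A p.1 p.2).
Definition lambda_cc A : rat :=
  mean (distinct_pairs c) (fun p => common_cc A p.1 p.2).
Definition lambda_rc A : rat :=
  mean [set: 'I_r * 'I_c] (fun p => common_rc A p.1 p.2).

Definition near_triple_array A : Prop :=
  [/\ binary A,
      equireplicate A \/ near_equireplicate A,
      forall i i' : 'I_r, i != i' ->
        is_floor_or_ceil (common_rr A i i') (lambda_rr A),
      forall j j' : 'I_c, j != j' ->
        is_floor_or_ceil (common_cc A j j') (lambda_cc A)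
    & forall (i : 'I_r) (j : 'I_c),
        is_floor_or_ceil (common_rc A i j) (lambda_rc A)].

End Design.

(* Main.v *)
From Stdlib Require Import Ascii String.
From HB Require Import structures.
Require Import Defs.
From mathcomp Require Import all_boot all_order all_algebra.
From mathcomp Require Import fingroup perm.
From mathcomp Require Import zify lra.

(** Everything rests on one observation: an integer is the floor or the ceiling
    of a rational number x exactly when it lies at distance less than 1 from x.
    So each of the four balance conditions (replications, two rows, two columns,
    a row and a column) says that a family of integers stays within distance 1
    of its average, which happens as soon as all its members lie in a window
    {n, n + 1}. Conversely, double counting expresses the four averages through
    c, v and the sum of the squared replications, so a near triple array forces
    explicit numerical windows.

    Existence. If k v <= 4 c <= (k + 1) v and c is not too small, the average
    number of common symbols of two columns is at most 1, and it suffices that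
    replications and row-column numbers lie in {k, k + 1}, column-column numbers
    in {0, 1}, and row-row numbers in any window. Putting two such arrays with
    disjoint symbol sets side by side keeps the first three windows, since
    columns of different parts share nothing, and adds the row-row numbers;
    the last window survives if one of the two parts has constant row-row
    numbers (sparseD). For k = 1, 2, 3, splitting off such parts reduces every
    large size to finitely many sizes, which are realized by explicit arrays
    (sparse_existence); for 4 c <= v all cells can be different. The arrays with
    few columns, where columns meet more often, are listed one by one.

    Nonexistence. A row has c different symbols, so c <= v. For (4, 9), (5, 7),
    (5, 10), (6, 8) and (7, 9), linear equations determine, up to a few cases,
    how many symbols have a given set of rows; once these sets are known, the
    possible columns are few, and an exhaustive search finds no compatible
    choice of columns. For (10, 12) and (11, 13) the symbols occur 3 or 4 times;
    call the latter heavy, and let w(j) be the number of heavy symbols of the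
    column j, which then has 4 - w(j) light ones. Counting the columns met by j
    gives 8 + w(j) common symbols in total.
    - (11, 13): two columns share at most one symbol, so w <= 2, and the 5 heavy
      symbols meet a light one in at most 5 columns altogether. Hence each of
      the 8 light symbols has a column with w <= 1; there is not enough room for
      that because the sum of 2 - w(j) is only 2 (no_incidence_11_13).
    - (10, 12): two columns share 1 or 2 symbols, and only 3 pairs share 2.
      Counting the common columns of a heavy and a light symbol yields a column
      with w >= 3 (exists_weight_ge3). A column with w = 3 contradicts the count
      of common symbols around its only light symbol (weight_neq3). If w(p) = 4,
      the other 9 columns pairwise share exactly one symbol and behave like an
      affine plane of order 3; the two light symbols missing from a given row
      are parallel lines, and the third line of their class must be heavy, which
      gives the heavy symbols too many common columns (weight_neq4). *)

Set Implicit Arguments.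
Unset Strict Implicit.
Unset Printing Implicit Defensive.

Import Order.TTheory GRing.Theory Num.Theory.

(** * Averages and windows *)

Section Averages.
Local Open Scope ring_scope.

Lemma is_floor_or_ceilP (n : nat) (x : rat) :
  is_floor_or_ceil n x <-> n%:R - 1 < x < n%:R + 1.
Proof.
have natE : n%:R = (n%:Z)%:~R :> rat by [].
have [lo hi] := (Num.Theory.floor_le x, Num.Theory.floorD1_gt x).
have [lo' hi'] := (Num.Theory.ceil_ge x, Num.Theory.ceilB1_lt x).
move: lo hi lo' hi'; rewrite /is_floor_or_ceil natE.
set fx := Num.floor x; set cx := Num.ceil x; rewrite intrD intrB => lo hi lo' hi'.
split=> [[->|->]|/andP[H1 H2]]; [lra | lra |].
have [E|lt_fx] : n%:Z = fx \/ (fx < n%:Z)%R.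
- have : (fx < n%:Z + 1)%R by rewrite -(ltr_int rat) intrD; lra.
  lia.
- by left.
right.
have : (n%:Z - 1 < cx)%R by rewrite -(ltr_int rat) intrB; lra.
have : ((n%:Z - 1)%:~R < x) by rewrite intrB; lra.
have : (cx < n%:Z + 1)%R.
  rewrite -(ltr_int rat) intrD.
  have : x <= (n%:Z)%:~R.
    have : (fx + 1)%:~R <= (n%:Z)%:~R :> rat by rewrite ler_int; lia.
    by rewrite intrD; lra.
  by lra.
lia.
Qed.

End Averages.

Lemma natr_div_lt (a b d : nat) : 0 < d ->
  ((a%:R / d%:R < b%:R :> rat)%R = (a < b * d)).
Proof. by move=> d0; rewrite ltr_pdivrMr ?ltr0n // -natrM ltr_nat. Qed.

Lemma natr_lt_div (a b d : nat) : 0 < d ->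
  ((b%:R < a%:R / d%:R :> rat)%R = (b * d < a)).
Proof. by move=> d0; rewrite ltr_pdivlMr ?ltr0n // -natrM ltr_nat. Qed.

(** The form in which the averages are used: a statement about integers only,
    within the reach of linear arithmetic. *)
Lemma floor_or_ceil_ratio (n a d : nat) : 0 < d ->
  is_floor_or_ceil n (a%:R / d%:R)%R <-> a < d * n + d /\ d * n < a + d.
Proof.
move=> d0; rewrite is_floor_or_ceilP.
have d0' : (0 < d%:R :> rat)%R by rewrite ltr0n.
rewrite natr1 natr_div_lt // ltrBlDr.
rewrite -[X in (_ < _ + X)%R](@divff _ d%:R%R) ?gt_eqF // -mulrDl -natrD natr_lt_div //.
rewrite mulSnr [n * d]mulnC.
by split=> [/andP[]|[-> ->]].
Qed.

Lemma meanE (I : finType) (S : {set I}) (f : I -> nat) :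
  mean S f = ((\sum_(i in S) f i)%:R / #|S|%:R)%R.
Proof. by rewrite /mean natr_sum. Qed.

(** The window determines floor and ceiling of the mean: a value q cannot be at
    distance 1 from the mean, because it contributes to the mean itself. *)
Lemma window_floor_or_ceil (I : finType) (S : {set I}) (f : I -> nat) (q : nat) :
  (forall i, i \in S -> q <= f i <= q.+1) ->
  forall i, i \in S -> is_floor_or_ceil (f i) (mean S f).
Proof.
move=> window i iS.
have S0 : 0 < #|S| by apply/card_gt0P; exists i.
rewrite meanE floor_or_ceil_ratio // (big_setD1 _ iS) /=.
have -> : #|S| = #|S :\ i|.+1 by rewrite (cardsD1 i) iS.
have lo : #|S :\ i| * q <= \sum_(j in S :\ i) f j.
  rewrite -sum_nat_const; apply: leq_sum => j /setD1P[_ jS].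
  by have /andP[] := window j jS.
have hi : \sum_(j in S :\ i) f j <= #|S :\ i| * q.+1.
  rewrite -sum_nat_const; apply: leq_sum => j /setD1P[_ jS].
  by have /andP[] := window j jS.
have /andP[flo fhi] := window i iS.
nia.
Qed.

Section Counting.
Variables r c v : nat.
Implicit Type A : row_column_design r c v.

(** Double counting of the triples (i, j, s) with s in both sets. *)
Lemma sum_card_setI (I J V : finType) (X : I -> {set V}) (Y : J -> {set V}) :
  \sum_i \sum_j #|X i :&: Y j| =
  \sum_s #|[set i | s \in X i]| * #|[set j | s \in Y j]|.
Proof.
have cardE (K : finType) (Z : K -> {set V}) s :
    #|[set i | s \in Z i]| = \sum_i (s \in Z i : nat).
  by rewrite -sum1_card big_mkcond; apply: eq_bigr => i _; rewrite inE; case: ifP.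
under [RHS]eq_bigr => s _ do rewrite !cardE big_distrlr.
rewrite [RHS]exchange_big; apply: eq_bigr => i _.
rewrite [RHS]exchange_big; apply: eq_bigr => j _ /=.
rewrite -sum1_card big_mkcond; apply: eq_bigr => s _.
by rewrite inE; do 2!case: (_ \in _).
Qed.

(** Splits a symmetric double sum into the two triangles and the diagonal; the
    factor 2 avoids a division. *)
Lemma sum_distinct_pairs n (f : 'I_n -> 'I_n -> nat) :
  (forall i j, f i j = f j i) ->
  2 * \sum_(p in distinct_pairs n) f p.1 p.2 + \sum_i f i i = \sum_i \sum_j f i j.
Proof.
move=> fC; rewrite pair_big /=.
rewrite [RHS](bigID (fun p : 'I_n * 'I_n => p.1 < p.2)) /= mul2n -addnn -addnA.
congr (_ + _); first by apply: eq_bigl => p; rewrite inE.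
rewrite [RHS](bigID (fun p : 'I_n * 'I_n => p.1 == p.2)) /= addnC; congr (_ + _).
  rewrite [RHS](reindex_onto (fun i => (i, i)) fst) /=; last first.
    by move=> [i j] /andP[_ /= /eqP->].
  by apply: eq_bigl => i; rewrite ltnn !eqxx.
rewrite (reindex_inj (h := fun p : 'I_n * 'I_n => (p.2, p.1))) /=; last first.
  by move=> [i j] [i' j'] [-> ->].
apply: eq_big => [[i j]|[i j] _]; last exact: fC.
by rewrite inE /= -val_eqE /=; lia.
Qed.

Lemma replication_rows A s : binary A ->
  replication A s = #|[set i | s \in row_symbols A i]|.
Proof.
move=> [rowI _]; rewrite /replication.
rewrite -(card_in_imset (f := fst)) => [|[i j] [i' j']]; last first.
  rewrite !inE /= => /eqP e1 /eqP e2 ei; rewrite -ei in e2 *.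
  by rewrite (rowI i j j') // e1 e2.
apply: eq_card => i; rewrite !inE.
apply/imsetP/imsetP => [[[i' j]]|[j _ ->]].
  by rewrite inE /= => /eqP<- ->; exists j.
by exists (i, j); rewrite ?inE.
Qed.

Lemma replication_cols A s : binary A ->
  replication A s = #|[set j | s \in col_symbols A j]|.
Proof.
move=> [_ colI]; rewrite /replication.
rewrite -(card_in_imset (f := snd)) => [|[i j] [i' j']]; last first.
  rewrite !inE /= => /eqP e1 /eqP e2 ej; rewrite -ej in e2 *.
  by rewrite (colI j i i') // e1 e2.
apply: eq_card => j; rewrite !inE.
apply/imsetP/imsetP => [[[i j']]|[i _ ->]].
  by rewrite inE /= => /eqP<- ->; exists i.
by exists (i, j); rewrite ?inE.
Qed.

Lemma sum_replication A : \sum_s replication A s = r * c.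
Proof.
transitivity #|{: 'I_r * 'I_c}|; last by rewrite card_prod !card_ord.
rewrite -sum1_card (partition_big (fun p => A p.1 p.2) predT) //=.
by apply: eq_bigr => s _; rewrite /replication -sum1_card; apply: eq_bigl => p; rewrite inE.
Qed.

Lemma avg_replicationE A : avg_replication r c v = mean [set: 'I_v] (replication A).
Proof.
rewrite meanE cardsT card_ord /avg_replication -(sum_replication A).
by under [in RHS]eq_bigl do rewrite inE.
Qed.

(** For an integral average, floor and ceiling coincide, so the two cases of the
    definition are one condition. *)
Lemma equireplicate_or_nearP A :
  equireplicate A \/ near_equireplicate A <->
  forall s, is_floor_or_ceil (replication A s) (avg_replication r c v).
Proof.
rewrite /equireplicate /near_equireplicate.
set e := avg_replication r c v; have [eint|eNint] := boolP (e \is a Num.int).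
  have floorE := Num.Theory.floorK eint; have ceilE := Num.Theory.ceilK eint.
  split=> [[[_ H] s|[]]|H] //.
    by left; apply/eqP; rewrite -(eqr_int rat) floorE; apply/eqP; exact: H.
  left; split=> // s; have : (replication A s)%:R%R = ((replication A s)%:Z%:~R : rat)%R by [].
  by case: (H s) => -> ->; rewrite ?floorE ?ceilE.
by split=> [[[]|[_ H]]|H] //; right.
Qed.

End Counting.

Section Windows.
Variables r c v : nat.
Implicit Type A : row_column_design r c v.

Lemma common_rrC A i i' : common_rr A i i' = common_rr A i' i.
Proof. by rewrite /common_rr setIC. Qed.

Lemma common_ccC A j j' : common_cc A j j' = common_cc A j' j.
Proof. by rewrite /common_cc setIC. Qed.

Lemma distinct_pairsP n (i j : 'I_n) :
  i != j -> (i, j) \in distinct_pairs n \/ (j, i) \in distinct_pairs n.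
Proof. by rewrite -val_eqE !inE /= neq_ltn => /orP[]; [left|right]. Qed.

Lemma near_triple_array_of_windows A qe qrr qcc qrc :
  binary A ->
  (forall s, qe <= replication A s <= qe.+1) ->
  (forall i i' : 'I_r, i < i' -> qrr <= common_rr A i i' <= qrr.+1) ->
  (forall j j' : 'I_c, j < j' -> qcc <= common_cc A j j' <= qcc.+1) ->
  (forall i j, qrc <= common_rc A i j <= qrc.+1) ->
  near_triple_array A.
Proof.
move=> binA repA rrA ccA rcA; split=> //.
- apply/equireplicate_or_nearP => s; rewrite (avg_replicationE A).
  exact: (window_floor_or_ceil (fun s _ => repA s)).
- have wrr p : p \in distinct_pairs r -> is_floor_or_ceil (common_rr A p.1 p.2) (lambda_rr A).
    by move: p; apply: (window_floor_or_ceil (q := qrr)) => -[k l]; rewrite inE => /rrA.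
  by move=> i i' /distinct_pairsP[/wrr //|/wrr /=]; rewrite common_rrC.
- have wcc p : p \in distinct_pairs c -> is_floor_or_ceil (common_cc A p.1 p.2) (lambda_cc A).
    by move: p; apply: (window_floor_or_ceil (q := qcc)) => -[k l]; rewrite inE => /ccA.
  by move=> j j' /distinct_pairsP[/wcc //|/wcc /=]; rewrite common_ccC.
- move=> i j.
  exact: (window_floor_or_ceil (fun p _ => rcA p.1 p.2) (in_setT (i, j))).
Qed.

Lemma card_row_symbols A i : binary A -> #|row_symbols A i| = c.
Proof. by case=> rowI _; rewrite card_imset ?card_ord. Qed.

Lemma card_col_symbols A j : binary A -> #|col_symbols A j| = r.
Proof. by case=> _ colI; rewrite card_imset ?card_ord. Qed.

Lemma card_distinct_pairs n : 2 * #|distinct_pairs n| = n * n.-1.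
Proof.
have := sum_distinct_pairs (fun=> fun=> erefl : 1 = 1) (n := n).
by rewrite !sum_nat_const !card_ord; case: n => [|n] /=; nia.
Qed.

Lemma sum_common_rr A : binary A ->
  2 * \sum_(p in distinct_pairs r) common_rr A p.1 p.2 + r * c =
  \sum_s replication A s ^ 2.
Proof.
move=> binA; have := sum_distinct_pairs (common_rrC A).
under [X in _ + X = _]eq_bigr => i _ do rewrite /common_rr setIid card_row_symbols //.
rewrite sum_nat_const card_ord => ->; rewrite sum_card_setI.
by apply: eq_bigr => s _; rewrite -replication_rows ?mulnn.
Qed.

Lemma sum_common_cc A : binary A ->
  2 * \sum_(p in distinct_pairs c) common_cc A p.1 p.2 + r * c =
  \sum_s replication A s ^ 2.
Proof.
move=> binA; have := sum_distinct_pairs (common_ccC A).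
under [X in _ + X = _]eq_bigr => i _ do rewrite /common_cc setIid card_col_symbols //.
rewrite sum_nat_const card_ord [c * r]mulnC => ->; rewrite sum_card_setI.
by apply: eq_bigr => s _; rewrite -replication_cols ?mulnn.
Qed.

Lemma sum_common_rc A : binary A ->
  \sum_i \sum_j common_rc A i j = \sum_s replication A s ^ 2.
Proof.
move=> binA; rewrite sum_card_setI.
by apply: eq_bigr => s _; rewrite -replication_rows -?replication_cols ?mulnn.
Qed.

(** All the averages are known once the sum S of the squared replications is: S
    is the total of the row-column numbers, and S - r c is the total of the
    row-row and of the column-column numbers over ordered pairs. *)
Lemma near_triple_array_bounds A (S := \sum_s replication A s ^ 2) :
  near_triple_array A ->
  [/\ forall s, r * c < v * replication A s + v /\ v * replication A s < r * c + v,
      forall i i', i != i' ->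
        S < r * r.-1 * common_rr A i i' + r * r.-1 + r * c /\
        r * r.-1 * common_rr A i i' + r * c < S + r * r.-1,
      forall j j', j != j' ->
        S < c * c.-1 * common_cc A j j' + c * c.-1 + r * c /\
        c * c.-1 * common_cc A j j' + r * c < S + c * c.-1
    & forall i j,
        S < r * c * common_rc A i j + r * c /\
        r * c * common_rc A i j < S + r * c].
Proof.
move=> [binA repA rrA ccA rcA]; split.
- move=> s; have v0 : 0 < v by case: s => m /= /(leq_ltn_trans (leq0n m)).
  by have /equireplicate_or_nearP /(_ s) := repA; rewrite floor_or_ceil_ratio.
- move=> i i' ne; have P0 : 0 < #|distinct_pairs r|.
    by apply/card_gt0P; case: (distinct_pairsP ne) => ?; [exists (i, i')|exists (i', i)].
  have := rrA i i' ne; rewrite /lambda_rr meanE floor_or_ceil_ratio //.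
  by have := sum_common_rr binA; have := card_distinct_pairs r; rewrite -/S; nia.
- move=> j j' ne; have P0 : 0 < #|distinct_pairs c|.
    by apply/card_gt0P; case: (distinct_pairsP ne) => ?; [exists (j, j')|exists (j', j)].
  have := ccA j j' ne; rewrite /lambda_cc meanE floor_or_ceil_ratio //.
  by have := sum_common_cc binA; have := card_distinct_pairs c; rewrite -/S; nia.
- move=> i j; have := rcA i j; rewrite /lambda_rc meanE.
  have -> : #|[set: 'I_r * 'I_c]| = r * c by rewrite cardsT card_prod !card_ord.
  have -> : \sum_(p in [set: 'I_r * 'I_c]) common_rc A p.1 p.2 = S.
    by rewrite /S -(sum_common_rc binA) pair_big; apply: eq_bigl => p; rewrite inE.
  rewrite floor_or_ceil_ratio //.
  by case: r c i j => [|r'] [|c'] // [] // ? ? [].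
Qed.

End Windows.

(** * Juxtaposition of arrays *)

(** Common symbols of two duplicate-free lists. Arrays are now lists of columns,
    each a list of four natural numbers, so that their properties can be
    evaluated. *)
Definition common (s t : seq nat) : nat := count (mem t) s.

Definition line (cols : seq (seq nat)) (i : nat) : seq nat :=
  [seq nth 0 x i | x <- cols].

Definition is_design (c v : nat) (cols : seq (seq nat)) : bool :=
  [&& size cols == c,
      all (fun x => [&& size x == 4, uniq x & all (gtn v) x]) cols
    & all (fun i => uniq (line cols i)) (iota 0 4)].

(** The lower and upper bounds for the row-row numbers are independent, which
    allows lo = hi: rows that meet equally often. *)
Definition has_windows (qe lo hi qcc qrc v : nat) (cols : seq (seq nat)) : bool :=
  [&& all (fun s => qe <= count_mem s (flatten cols) <= qe.+1) (iota 0 v),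
      all (fun i => all (fun i' => (i < i') ==>
        (lo <= common (line cols i) (line cols i') <= hi)) (iota 0 4)) (iota 0 4),
      pairwise (fun x y => qcc <= common x y <= qcc.+1) cols
    & all (fun i => all (fun x => qrc <= common x (line cols i) <= qrc.+1) cols)
        (iota 0 4)].

Section ArrayOfColumns.
Variables (c v : nat) (cols : seq (seq nat)).
Hypothesis dcols : is_design c v.+1 cols.

Definition array_of_cols : row_column_design 4 c v.+1 :=
  (\matrix_(i, j) inord (nth 0%N (nth [::] cols j) i))%R.

Let A := array_of_cols.

Lemma size_cols : size cols = c.
Proof. by case/and3P: dcols => /eqP. Qed.

Lemma column_of (j : 'I_c) :
  [/\ size (nth [::] cols j) = 4, uniq (nth [::] cols j)
    & forall x, x \in nth [::] cols j -> x < v.+1].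
Proof.
case/and3P: dcols => /eqP sc /allP/(_ (nth [::] cols j)) colP _.
have /colP/and3P[/eqP ? ? /allP lt_v] : nth [::] cols j \in cols by rewrite mem_nth ?sc.
by split.
Qed.

Lemma val_array_of_cols i j : val (A i j) = nth 0 (nth [::] cols j) i.
Proof.
have [szj _ ltj] := column_of j.
by rewrite mxE /= inordK // ltj // mem_nth ?szj.
Qed.

Lemma uniq_line (i : 'I_4) : uniq (line cols i).
Proof. by case/and3P: dcols => _ _ /allP/(_ (val i)); apply; rewrite mem_iota ltn_ord. Qed.

Lemma nth_line i (j : 'I_c) : nth 0 (line cols i) j = nth 0 (nth [::] cols j) i.
Proof. by rewrite (nth_map [::]) ?size_cols. Qed.

Lemma binary_array_of_cols : binary A.
Proof.
split=> [i j j' /(congr1 val)|j i i' /(congr1 val)]; rewrite !val_array_of_cols.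
  rewrite -!nth_line => /eqP; rewrite nth_uniq ?uniq_line ?size_map ?size_cols //.
  by move=> /eqP/val_inj.
have [szj uj _] := column_of j.
by move=> /eqP; rewrite nth_uniq ?szj // => /eqP/val_inj.
Qed.

Lemma mem_row_symbols i s : (s \in row_symbols A i) = (val s \in line cols i).
Proof.
apply/imsetP/idP => [[j _ ->]|/(nthP 0)[j]].
  by rewrite val_array_of_cols -nth_line mem_nth ?size_map ?size_cols.
rewrite size_map size_cols => ltj; rewrite -[j]/(val (Ordinal ltj)) nth_line => E.
by exists (Ordinal ltj) => //; apply: val_inj; rewrite val_array_of_cols E.
Qed.

Lemma mem_col_symbols j s : (s \in col_symbols A j) = (val s \in nth [::] cols j).
Proof.
have [szj _ _] := column_of j.
apply/imsetP/idP => [[i _ ->]|/(nthP 0)[i]].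
  by rewrite val_array_of_cols mem_nth ?szj.
rewrite szj => lti; rewrite -[i]/(val (Ordinal lti)) => E.
by exists (Ordinal lti) => //; apply: val_inj; rewrite val_array_of_cols E.
Qed.

Lemma card_common (X Y : {set 'I_v.+1}) (s t : seq nat) :
  uniq s -> (forall x, x \in s -> x < v.+1) ->
  (forall x, (x \in X) = (val x \in s)) -> (forall x, (x \in Y) = (val x \in t)) ->
  #|X :&: Y| = common s t.
Proof.
move=> us lts XE YE; rewrite cardE -(size_map val) /common -size_filter.
apply/perm_size/uniq_perm; rewrite ?filter_uniq ?(map_inj_uniq val_inj) ?enum_uniq //.
move=> x; rewrite mem_filter; apply/mapP/andP => [[y]|[/= xt xs]].
  by rewrite mem_enum inE XE YE => /andP[ys yt] ->.
by exists (Ordinal (lts x xs)); rewrite ?mem_enum ?inE ?XE ?YE /= ?xs.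
Qed.

Lemma replication_array_of_cols s :
  replication A s = count_mem (val s) (flatten cols).
Proof.
rewrite (replication_cols _ binary_array_of_cols) count_flatten sumnE big_map.
rewrite (big_nth [::]) size_cols big_mkord -sum1_card big_mkcond.
apply: eq_bigr => j _; have [_ uj _] := column_of j.
by rewrite inE mem_col_symbols count_uniq_mem //; case: ifP.
Qed.

Lemma near_triple_array_of_cols qe qrr qcc qrc :
  has_windows qe qrr qrr.+1 qcc qrc v.+1 cols -> near_triple_array A.
Proof.
case/and4P=> /allP repA /allP rrA ccA /allP rcA.
have line_lt i x : x \in line cols (nat_of_ord (i : 'I_4)) -> x < v.+1.
  case/(nthP 0) => j; rewrite size_map size_cols => ltj.
  rewrite -[j]/(val (Ordinal ltj)) nth_line => <-.
  by have [szj _ ltv] := column_of (Ordinal ltj); rewrite ltv // mem_nth // szj.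
apply: (near_triple_array_of_windows (qe := qe) (qrr := qrr) (qcc := qcc) (qrc := qrc)).
- exact: binary_array_of_cols.
- by move=> s; rewrite replication_array_of_cols repA // mem_iota ltn_ord.
- move=> i i' lt_ii'; rewrite /common_rr.
  rewrite (card_common (uniq_line i) (@line_lt i) (mem_row_symbols i) (mem_row_symbols i')).
  have mem4 (k : 'I_4) : val k \in iota 0 4 by rewrite mem_iota ltn_ord.
  by have /allP/(_ _ (mem4 i')) := rrA _ (mem4 i); rewrite lt_ii'.
- move=> j j' lt_jj'; have [_ uj ltj] := column_of j.
  rewrite /common_cc (card_common uj ltj (mem_col_symbols j) (mem_col_symbols j')).
  by move/pairwiseP: ccA => /(_ [::]); apply; rewrite ?inE ?size_cols.
- move=> i j; have [_ uj ltj] := column_of j.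
  rewrite /common_rc setIC (card_common uj ltj (mem_col_symbols j) (mem_row_symbols i)).
  have mem4 : val i \in iota 0 4 by rewrite mem_iota ltn_ord.
  have /allP := rcA _ mem4; apply.
  by rewrite mem_nth ?size_cols.
Qed.

End ArrayOfColumns.

Definition juxtapose (v1 : nat) (cols1 cols2 : seq (seq nat)) : seq (seq nat) :=
  cols1 ++ [seq [seq v1 + x | x <- col] | col <- cols2].

Section Juxtaposition.
Variable v1 : nat.
Implicit Types s t : seq nat.

Let shift s := [seq v1 + x | x <- s].

Lemma common_shift s t : common (shift s) (shift t) = common s t.
Proof.
rewrite /common count_map; apply: eq_count => x /=.
by rewrite mem_map //; apply: addnI.
Qed.

Lemma common_below_shift s t : all (gtn v1) s -> common s (shift t) = 0.
Proof.
move=> /allP lts; apply/eqP; rewrite -leqn0 leqNgt -has_count; apply/hasP => -[x /lts /=].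
by move=> lt_x /mapP[y _]; lia.
Qed.

Lemma common_shift_below s t : all (gtn v1) t -> common (shift s) t = 0.
Proof.
move=> /allP ltt; apply/eqP; rewrite -leqn0 leqNgt -has_count; apply/hasP => -[x].
by move=> /mapP[y _ ->] /ltt /=; lia.
Qed.

Lemma common_catl s s' t : common (s ++ s') t = common s t + common s' t.
Proof. exact: count_cat. Qed.

Lemma common_catr s t t' :
  all (gtn v1) t -> common s (t ++ shift t') = common s t + common s (shift t').
Proof.
move=> /allP ltt; rewrite /common -count_predUI -[LHS]addn0; congr (_ + _).
  by apply: eq_count => x; rewrite !inE mem_cat.
apply/esym/eqP; rewrite -leqn0 leqNgt -has_count; apply/hasP => -[x _ /=].
by move=> /andP[/ltt /= ltx /mapP[y _]]; lia.
Qed.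

Variables (c1 c2 v2 : nat) (cols1 cols2 : seq (seq nat)).
Hypotheses (d1 : is_design c1 v1 cols1) (d2 : is_design c2 v2 cols2).

Let cols := juxtapose v1 cols1 cols2.

Lemma line_juxtapose i : i < 4 -> line cols i = line cols1 i ++ shift (line cols2 i).
Proof.
move=> lti; rewrite /shift /line map_cat -!map_comp; congr (_ ++ _).
apply/eq_in_map => x xcols /=.
have /and3P[_ /allP/(_ x xcols) /andP[/eqP szx _] _] := d2.
by rewrite (nth_map 0) ?szx.
Qed.

Lemma line_below i : i < 4 -> all (gtn v1) (line cols1 i).
Proof.
move=> lti; apply/allP => _ /mapP[x xcols ->].
have /and3P[_ /allP/(_ x xcols) /and3P[/eqP szx _ /allP ltx] _] := d1.
by rewrite ltx // mem_nth ?szx.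
Qed.

Lemma column_below x : x \in cols1 -> all (gtn v1) x.
Proof. by move=> xcols; case/and3P: d1 => _ /allP/(_ x xcols)/and3P[]. Qed.

Lemma is_design_juxtapose : is_design (c1 + c2) (v1 + v2) cols.
Proof.
have /and3P[/eqP sz1 /allP col1 /allP row1] := d1.
have /and3P[/eqP sz2 /allP col2 /allP row2] := d2.
apply/and3P; split.
- by rewrite size_cat size_map sz1 sz2.
- rewrite all_cat all_map; apply/andP; split; apply/allP => x.
    move/col1 => /and3P[-> -> /allP ltx] /=.
    by apply/allP => y /ltx /=; lia.
  move/col2 => /and3P[/eqP szx ux /allP ltx] /=.
  rewrite size_map szx map_inj_uniq ?ux //=; last exact: addnI.
  by rewrite all_map; apply/allP => y /ltx /=; lia.
- apply/allP => i i4; rewrite line_juxtapose; last by rewrite mem_iota in i4.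
  rewrite cat_uniq row1 // map_inj_uniq ?row2 ?andbT //=; last exact: addnI.
  apply/hasPn => y /mapP[x _ ->]; apply/negP.
  have /allP below : all (gtn v1) (line cols1 i).
    by apply: line_below; rewrite mem_iota in i4.
  by move/below => /=; lia.
Qed.

(** The windows for columns must start at 0, because columns of different parts
    share no symbol. Row-row numbers add up, whence the constant q on one side:
    two windows of width 1 would only give a window of width 2. *)
Lemma has_windows_juxtapose k q lo hi :
  has_windows k q q 0 k v1 cols1 -> has_windows k lo hi 0 k v2 cols2 ->
  has_windows k (q + lo) (q + hi) 0 k (v1 + v2) cols.
Proof.
case/and4P=> /allP rep1 /allP rr1 cc1 /allP rc1.
case/and4P=> /allP rep2 /allP rr2 cc2 /allP rc2.
have flat2 : flatten [seq shift x | x <- cols2] = shift (flatten cols2).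
  by rewrite /shift map_flatten.
have /allP flat1 : all (gtn v1) (flatten cols1).
  by apply/allP => y /flattenP[x /column_below /allP]; apply.
apply/and4P; split.
- apply/allP => s; rewrite mem_iota add0n => /= lts.
  rewrite /cols /juxtapose flatten_cat count_cat flat2.
  have [lt_s|le_s] := ltnP s v1.
    have /count_memPn -> : s \notin shift (flatten cols2).
      by apply/mapP => -[x _]; lia.
    by rewrite addn0 rep1 // mem_iota.
  have /count_memPn -> : s \notin flatten cols1.
    by apply/negP => /flat1 /=; lia.
  have -> : count_mem s (shift (flatten cols2)) = count_mem (s - v1) (flatten cols2).
    by rewrite count_map; apply: eq_count => x /=; apply/eqP/eqP; lia.
  by rewrite rep2 // mem_iota; lia.
- apply/allP => i i4; apply/allP => i' i'4; apply/implyP => lt_ii'.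
  have := allP (rr1 i i4) i' i'4; have := allP (rr2 i i4) i' i'4.
  rewrite lt_ii' /=; rewrite !mem_iota /= in i4 i'4.
  rewrite !line_juxtapose // common_catl !common_catr ?line_below //.
  rewrite common_shift common_below_shift ?line_below //.
  by rewrite common_shift_below ?line_below //; lia.
- rewrite /cols /juxtapose pairwise_cat cc1 pairwise_map /=; apply/andP; split.
    apply/allrelP => x _ xcols /mapP[y _ ->].
    by rewrite common_below_shift ?column_below.
  by apply: etrans cc2; apply: eq_pairwise => x y; rewrite /= common_shift.
- apply/allP => i i4; have := rc1 i i4; have := rc2 i i4.
  rewrite !mem_iota /= in i4; rewrite line_juxtapose // all_cat all_map => /allP h2 /allP h1.
  apply/andP; split; apply/allP => x xcols /=; rewrite common_catr ?line_below //.
    by rewrite common_below_shift ?column_below // addn0 h1.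
  by rewrite common_shift_below ?line_below // common_shift h2.
Qed.

End Juxtaposition.

(** The arrays that can be juxtaposed; q is left open because row-row numbers
    add up. *)
Definition sparse (k c v : nat) : Prop :=
  exists cols q, is_design c v cols && has_windows k q q.+1 0 k v cols.

Definition sparse_exact (k c v : nat) : Prop :=
  exists cols q, is_design c v cols && has_windows k q q 0 k v cols.

Lemma sparseD k c1 v1 c2 v2 :
  sparse_exact k c1 v1 -> sparse k c2 v2 -> sparse k (c1 + c2) (v1 + v2).
Proof.
move=> [cols1 [q1 /andP[d1 w1]]] [cols2 [q2 /andP[d2 w2]]].
exists (juxtapose v1 cols1 cols2), (q1 + q2).
by rewrite (is_design_juxtapose d1 d2) -addnS (has_windows_juxtapose d1 d2).
Qed.

Lemma near_triple_array_of_sparse k c v : 0 < v ->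
  sparse k c v -> exists A : row_column_design 4 c v, near_triple_array A.
Proof.
case: v => // v _ [cols [q /andP[d w]]].
by exists (array_of_cols c v cols); apply: near_triple_array_of_cols w.
Qed.

(** * Existence *)

HB.instance Definition _ := hasDecEq.Build string String.eqb_spec.

(** Symbols are written 0, ..., 9, a, ..., z; 48 is the code of the character 0
    and 87 + 10 that of a. *)
Definition digit (a : ascii) : nat :=
  let n := nat_of_ascii a in if n < 58 then n - 48 else n - 87.

Fixpoint words (s : string) : seq (seq nat) :=
  if s isn't String a s' then [:: [::]] else
  if Ascii.eqb a " " then [::] :: words s' else
  if words s' is w :: ws then (digit a :: w) :: ws else [::].

Definition columns (c : nat) (s : string) : seq (seq nat) :=
  let rows := words s in [seq [seq nth 0 row j | row <- rows] | j <- iota 0 c].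

(** An entry (c, v, t) is a 4 x c array on v symbols; the four words of t are its
    rows. The arrays come from a randomized search, and the properties that
    matter are recomputed below. In this list the column-column average exceeds
    1. *)
Definition dense_arrays : seq (nat * nat * string) :=
 [:: (4, 4, "0123 3012 2301 1230");
     (4, 5, "0123 3412 1204 4031");
     (4, 6, "0123 2405 4031 1542");
     (4, 7, "0123 1245 5036 4601");
     (4, 8, "0123 2451 4637 7065");
     (5, 5, "01234 32140 13402 24013");
     (5, 6, "01234 45301 10523 34152");
     (5, 8, "01234 35671 12506 57460");
     (5, 9, "01234 45617 70852 36485");
     (6, 6, "012345 201534 120453 534021");
     (6, 7, "012345 460531 206413 153062");
     (6, 9, "012345 503674 624810 276158");
     (6, 10, "012345 406781 965438 637129");
     (7, 7, "0123456 4230615 5046132 2365041");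
     (7, 8, "0123456 1354067 3647102 5430271");
     (7, 10, "0123456 2478309 7692584 6815793");
     (7, 11, "0123456 7468391 4281a75 697023a");
     (8, 8, "01234567 14067235 52176403 63725041");
     (8, 9, "01234567 50481376 62845103 23107684");
     (8, 10, "01234567 84053279 79468123 15682390");
     (8, 11, "01234567 6508792a 9a158340 178692a3");
     (9, 9, "012345678 237561804 845702316 378024165");
     (9, 10, "012345678 671902584 967830452 783561249");
     (9, 11, "012345678 4916a0583 14372a950 678a01249");
     (10, 10, "0123456789 9451268370 7219304568 6078931425");
     (10, 11, "0123456789 a604819573 70826a3145 643a581290");
     (11, 11, "0123456789a 87340126a59 3251798a046 794a6015283");
     (11, 12, "0123456789a 206b5a48931 b53798021a4 57146389b02");
     (12, 12, "0123456789ab 9260a781b435 1497ba062583 a03b62589741")]%string.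

Definition sparse_arrays : seq (nat * nat * string) :=
 [:: (1, 4, "0 1 2 3");
     (4, 10, "0123 4356 7860 2489");
     (4, 11, "0123 4506 1678 829a");
     (4, 12, "0123 4567 8491 3ab6");
     (4, 13, "0123 4567 8609 5abc");
     (4, 14, "0123 4567 89a4 bc5d");
     (4, 15, "0123 4567 89ab cd5e");
     (5, 11, "01234 50627 48156 97a83");
     (5, 12, "01234 35678 897a1 9b046");
     (5, 13, "01234 54672 7891a a60bc");
     (6, 11, "012345 164789 9570a3 2a5608");
     (6, 12, "012345 673859 9470ab 26ab81");
     (6, 13, "012345 607859 ab197c c864b2");
     (6, 14, "012345 167829 abc4d6 d3b790");
     (7, 12, "0123456 750894a 67958b3 8ab2169");
     (7, 13, "0123456 70489ab c9a2367 3acb581");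
     (7, 14, "0123456 37689ab 74c25bd ca9d801");
     (7, 15, "0123456 2789a4b b9c81d5 d6e0c7a");
     (8, 12, "01234567 58692a1b 958473a6 2731ab09");
     (8, 13, "01234567 876902a4 b6c59108 2b971a3c");
     (8, 14, "01234567 17089a3b 685cb79d d2b41ca3");
     (8, 15, "01234567 18396abc bdc5e874 e4db902a");
     (8, 16, "01234567 89a2bcd6 a3ef940c 1d5b78fe");
     (8, 17, "01234567 8569abc3 49dec2fg bda07e1f");
     (9, 12, "012345678 934a57b80 6790124ab 5982ab361");
     (9, 13, "012345678 3549168ab c2370b961 acb590247");
     (9, 14, "012345678 976501abc 820b1c9d3 59c2ad347");
     (9, 15, "012345678 12895abc4 85acd706e de30b9a27");
     (9, 16, "012345678 893abc72d e3f6a0b94 7ced1a54f");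
     (9, 17, "012345678 49a7b13cd a86efbd0g 5e9f2dcg4");
     (9, 18, "012345678 59ab0cde7 f39eg24hd hc68agb1f");
     (9, 19, "012345678 249a6bcde bf8gh17ac hdf9gei50");
     (10, 13, "0123456789 597a018bc6 3258a4b90c b0a16c2473");
     (10, 14, "0123456789 87413a9bcd a67c0935d2 2ac5d4b061");
     (10, 15, "0123456789 5abc21d648 ad389e527b b710d93ce6");
     (10, 16, "0123456789 2a59bc83de ce1f28a0b7 63fba47d1c");
     (10, 17, "0123456789 9a14bc8d3e f0gc28b97a 47dg5ea6f2");
     (10, 18, "0123456789 ab1cd3ef40 68eg5hb2cd 8hg7af3d9e");
     (10, 19, "0123456789 ab3cd948ef 74e0fb2ghi diah5gc316");
     (10, 20, "0123456789 a4bcde39fg 5h1ijcfad2 bge876jh0i");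
     (10, 21, "0123456789 ab9c805def 32gdfhib6j kec1ija4g7");
     (11, 14, "0123456789a b369a25c08d 1d4bc9a0567 25d73cb6418");
     (11, 15, "0123456789a bcd12e46758 6208ead39cb 1a7d309ceb4");
     (11, 16, "0123456789a 2bc618d0e53 d24b809c73f a954df71bec");
     (11, 17, "0123456789a 7bc03d91ef6 f4bga3cd128 a079ec4g5db");
     (11, 18, "0123456789a b0c1de95f4g 7a4e86df0hc 2h6dg8b13f5");
     (11, 19, "0123456789a b0cde68fg57 ac318bh9ide 246gdif17ah");
     (11, 20, "0123456789a bc37d2eafg6 57dh0egi18j f9ijch4e2b8");
     (11, 21, "0123456789a bca1d03efgh 84gih6j5e3k kjif2cdb976");
     (11, 22, "0123456789a bcdefag532h gdi79jfkcl0 164iel8bjhk");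
     (12, 13, "0123456789ab 327c90b61a54 26c4513a7b80 94ba7c503128");
     (12, 14, "0123456789ab c95b6da21340 5abc1786203d 879153bcd624");
     (12, 15, "0123456789ab b40c92d35e1a 634adc5eb287 cb897130e6d2");
     (12, 16, "0123456789ab 67cd5e184fb2 5d1b93ac08fe f936c7ead240");
     (12, 17, "0123456789ab 76c92a3d45ef ef7dg8a69012 35810dgbfc4e");
     (12, 18, "0123456789ab c3b6d7e14f8g 4gdh9f2a1c60 e9305g7ch8da");
     (12, 19, "0123456789ab 1cde2f706gha 630i9cbhde5f ib52c7g8e14d");
     (12, 20, "0123456789ab cd6e7af0ghb9 ice08h429jf5 68jbhi1gf32d");
     (12, 21, "0123456789ab c2bde748fghi gedcjfak3607 5ck901f4ih2j");
     (12, 22, "0123456789ab c0de8f795ghi jeagk0d3li64 9kfbd31lj2ch");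
     (13, 13, "0123456789abc a680b93c17452 6704c8b53a219 c4798623ab501");
     (13, 14, "0123456789abc 1a35290b64cd8 45abd8c236701 369c50217b4ad");
     (13, 15, "0123456789abc 8b6d5370ca2e1 64cbd9a27e850 e84076b931d25");
     (13, 16, "0123456789abc 9b3de42cf5160 8d5a279e6bc0f d786a0194f5e3");
     (13, 17, "0123456789abc dcb20efg38916 68ad92715ef4g ad84g0b3f7ce5");
     (13, 18, "0123456789abc 3dc87eaf615gh eg5dh409f2b78 g4f236dabehc9");
     (13, 19, "0123456789abc 8ad130efcg49h bgei7a98d5h32 i71hdec654bf0");
     (13, 20, "0123456789abc de9fghb6172c4 603ga4ij95hed faicb1h3jd758");
     (13, 21, "0123456789abc dc52efb3ghi79 heij805k9631f 1j867gkcdafi4");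
     (13, 22, "0123456789abc defghiab97268 b058a4e1jgklf c9dhlejk25i31");
     (13, 23, "0123456789abc d9ef240ghij6k ljfbmie86dc57 751kl3mi2aegh");
     (14, 14, "0123456789abcd 17da5b3c928046 53c26d8a7b1490 cd802ab6514739");
     (14, 15, "0123456789abcd e26478b53d1a90 17a28bd6ce9305 8ce9a213d75064");
     (14, 16, "0123456789abcd 358a19ecbf7642 bac9801fe46d57 1f6d7893a204e5");
     (14, 17, "0123456789abcd 8eca9f0dg153b2 e41f2cg3b670a5 23g6f8dc75e94b");
     (14, 18, "0123456789abcd e6fc370gha8215 75d9afg26ebh4c db1f584392g0eh");
     (14, 19, "0123456789abcd 2d16e0fagh45b9 c53hdg8e2ai76f eif483019cbhg7");
     (14, 20, "0123456789abcd ef519gcbhi4627 76fhdaej58239i 480efdahcbigj1");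
     (14, 21, "0123456789abcd c4efgh3bi650d1 ied823a49f0hjk 2a5g67ji1kf8bh");
     (14, 22, "0123456789abcd ef3b6g9h5ij80a d57egckbl13fi6 jhi4128delkcaf");
     (14, 23, "0123456789abcd efc65ghi3j28kb 530lm1f4egi9ah 7dlmj80ka26f1e");
     (15, 15, "0123456789abcde e70b5d341ac2968 4e708a23d6195bc a5d8631c97b40e2");
     (15, 16, "0123456789abcde fe41093dcb5872a dbef325916470a8 80679fde2c15ab3");
     (15, 17, "0123456789abcde 7a4f102egc658bd f8bc9d517a3e6g4 bda269734eg80cf");
     (15, 18, "0123456789abcde 2af9dce0bg43h85 c07ebdf9a1526gh 83acef05hbg6471");
     (15, 19, "0123456789abcde a54fd0g91h2i8cb hg7c69abe8f3i54 e3h0i6c1fd927bg");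
     (15, 20, "0123456789abcde f20a7gedh54i38j eijfgah617c829b c469b15f0ij3hgd");
     (15, 21, "0123456789abcde 13f579ag4hei0bj je4hi2f0gcd6k58 dk38ci12aghjbf7");
     (15, 22, "0123456789abcde fb612ghic8jed3k 64107e9hjgdikla jhlgkfc57a290b3");
     (16, 16, "0123456789abcdef 5d87e4b9f6301ac2 867ed2a53c14f0b9 e8a6f35db4917c20");
     (16, 17, "0123456789abcdef 4e5f6gb2a39d7108 2965ea13b0cg87f4 158dc4fbe620ga79");
     (16, 18, "0123456789abcdef 7eb1g69f43da205h 96fc74d8a230hgbe h710bc832g56de9a");
     (16, 19, "0123456789abcdef 86ad5fgc9hi21704 he352acbf749i8g6 5h1g7ba0e396fi4d");
     (16, 20, "0123456789abcdef g6hei4982ajc301d bh796g0i3c185jf4 eb9ic2fa6g5jd78h");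
     (16, 21, "0123456789abcdef gea738hbfi94jkc2 8gb26i9jk15d3eh0 a2i5gcf614khd70j");
     (16, 22, "0123456789abcdef g071hibj5a38dfkl 49k67gfejlhi128c eh5lb6k394c2ijd0");
     (16, 23, "0123456789abcdef g2bh1i46ajk80e9l eg5l74ma3hcjdki2 53kbjf0gid1ml679");
     (17, 17, "0123456789abcdefg 8a60g7d3e594fb21c 94abd018637fec5g2 1e0g9c74b6f23ad58");
     (17, 18, "0123456789abcdefg dhcb19aeg3076f542 bde50843fhca12g76 85b426edagh1390c7");
     (17, 19, "0123456789abcdefg 5ha42i7de308gb619 f0h1ca8eg5b9624id ge6d740f2c3h15b8i");
     (17, 20, "0123456789abcdefg h7baf9g6d80534icj 9c4b561d3je0ihf2a g5ih3afj12780e9d4");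
     (17, 21, "0123456789abcdefg h64b0c5ig7jfd91ke 3gh45j8a06dibk7e2 fhckd3i49j1g728a5");
     (17, 22, "0123456789abcdefg hi0dg6jkfe8l9c73b 4ceajg83li09k25h1 b6jid0924f75alh1k");
     (17, 23, "0123456789abcdefg 89c47hig6j20k51l3 im6ha0bkfejl42g9d d8meia3bh51cfkl7j");
     (18, 18, "0123456789abcdefgh g6hd04293af8517bce 973cahdf1265eg40b8 80g9c14hfb572e3d6a");
     (18, 19, "0123456789abcdefgh 8071df53e4bcag96hi hg8if13c4b06e927ad 9e1a3chg5728d6fi4b");
     (18, 20, "0123456789abcdefgh 60h42i3c7d9jfb851g 5hj07d21ief8ga3b94 8bcjf4d3906gi7he2a");
     (18, 21, "0123456789abcdefgh i96g34hfe207db18jk g7jd6bf4hceak9i053 63b28kcd7eji1045ha");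
     (18, 22, "0123456789abcdefgh i5ja20f1kb6le384dg 7jalck2b3i58f4dh96 4807k9i6gedca1hl2j");
     (18, 23, "0123456789abcdefgh 27hijk84lmb9f53da1 4em6g3bchailj1dkf0 kl69dhjmc0eg5a872i");
     (19, 19, "0123456789abcdefghi 70eadch8354g96ibf12 e65b2i7ag1hd0984cf3 g3a90d2c54i1h8b76ef");
     (19, 20, "0123456789abcdefghi d7a65i8e94c30j1bfgh 7cbae6hj32f5i8g9401 9310dgc2ih5j4a8e7bf");
     (19, 21, "0123456789abcdefghi 391iha70jfb46kc8d2g 23f7jiecdbg65h1098k e5789da4bihkf3jg6c2");
     (19, 22, "0123456789abcdefghi j2k5geh4dl791bc3ifa 307cekj9ifl16ad8254 bf3lji981d6k45hgc70");
     (19, 23, "0123456789abcdefghi 63hf0j41dak529l8cim cm46edblg2ik7150fj9 jcle138fmb40kha95g7");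
     (19, 24, "0123456789abcdefghi 49gj2dbkcf317lm56an ljeg83ha9nmkib76045 70lcmhndkef36i18aj2");
     (20, 20, "0123456789abcdefghij 204gfhd1c7856ea3jb9i 6g87dihjbaf9351240ec idheb7j8g0619c25a34f");
     (20, 21, "0123456789abcdefghij 6gcd2keh48590f3b7i1a h3b961ifck4g5a08dj7e 1j72fd85ga369ik0eb4c");
     (20, 22, "0123456789abcdefghij 7fad8kl1ihc9ebj56g04 b01k7gdec8456i2l3f9h 6j8ef749gdb3h1ica2lk");
     (20, 23, "0123456789abcdefghij 6fk824ba70ej3glci1hm jeg5179l04cfmbid3k8a 58flcg7dkeh30mji6942");
     (20, 24, "0123456789abcdefghij 49cklbhfja52dim817en e6h810n2ml3df49ik5bg 7jkbhna6421g03flemci");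
     (20, 25, "0123456789abcdefghij 2kgj8l5dmnoa19h76fb4 njeo2gdl034kbi98fc5m 6eohi4c01ad8gkb3mln7");
     (21, 21, "0123456789abcdefghijk 6f8953cka4e7h20ibjdg1 469ja1dc3ik2fe5gh780b 2acdhi54gej30f7k68b19");
     (21, 22, "0123456789abcdefghijk ae6kd4h9b8i7l231fcg50 g57ab6d4kj10icl38e9hf j2fhek8ac3615g0dl9b7i");
     (21, 23, "0123456789abcdefghijk 9jl2ke5ci4hfg0a67b3m1 f6j87diecb0213kl5m9ah kb95d1m0a84i3jgehc7fl");
     (21, 24, "0123456789abcdefghijk j36ibh0eg2k894ldam5nf bj893dl6em7h5ckan42f1 5dcn26fi9047lgbm1jaeh");
     (22, 22, "0123456789abcdefghijkl ih69adlc4e75fbg210k3j8 9ej81kid2bg35l67c4fah0 jdch623ibk87laf0954eg1");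
     (22, 23, "0123456789abcdefghijkl g6emf2b14a379c05l8dkhj fkmjc45g70eaiblh826d31 2fcg3dj9k56h8l7ma10ei4");
     (22, 24, "0123456789abcdefghijkl c9m8k4i3gh0jb52afnl6d1 l0f4ma7dei28khn931gcj6 5d1lh78ba3kmif9c0gj4ne");
     (23, 23, "0123456789abcdefghijklm d372ma951ifejcgbl40k6h8 4mfjahd62l3i0k71cb58ge9 17c4gj3b52ka6idl89fehm0");
     (23, 24, "0123456789abcdefghijklm 1lijhc9dmakf034g5b87ne6 27b9d1f540le68gniahk3mj j4nhca7b9eik812036fgmd5");
     (23, 25, "0123456789abcdefghijklm 84n7h19j5mbe2icd6aoflgk hgf16da8elon309k275cibj 1j9okling8m6a4db75f02c3");
     (24, 24, "0123456789abcdefghijklmn 14hafen8ic9gl6b5jm7k2d03 bn76295gjkha0em8c4lf31di 9aec63704nlk28f1m5bhdjig");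
     (24, 25, "0123456789abcdefghijklmn fm9aol0ne486bhjck3d21g7i 4ic9625kblfn1g0m37od8eaj 1leo78954hng3amk2i06dfbc");
     (24, 26, "0123456789abcdefghijklmn fop47b9d38ij5ghe6kla20n1 a4hj075lim9p2kdg8fne1o3c 354dmanc1h28jpo9lbe67kgf");
     (25, 25, "0123456789abcdefghijklmno l3o702fmk18nejagd4bi96h5c c4eg2bj8lndmih315o9a076fk a8m9njofbe6cglk205d7h43i1")]%string.

(** If all replications e are k or k + 1, then e (e - 1) = 2 k e - k (k + 1).
    Summing over the v symbols gives this value, which counts the ordered pairs
    of cells with equal symbols: it is 12 times the row-row average and c (c - 1)
    times the column-column average. *)
Definition repetitions (k c v : nat) : nat := 8 * k * c - k * k.+1 * v.

Definition is_dense_array (t : nat * nat * string) : bool :=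
  let: (c, v, s) := t in let cols := columns c s in
  let k := (4 * c) %/ v in let m := repetitions k c v in
  is_design c v cols &&
  has_windows k (m %/ 12) (m %/ 12).+1 (m %/ (c * c.-1)) ((m + 4 * c) %/ (4 * c)) v cols.

(** With d = 1 this certifies a sparse array, with d = 0 one whose row-row
    numbers are constant. *)
Definition is_sparse_array (k : nat) (d : nat) (t : nat * nat * string) : bool :=
  let: (c, v, s) := t in let cols := columns c s in
  let q := repetitions k c v %/ 12 in
  is_design c v cols && has_windows k q (q + d) 0 k v cols.

Definition in_range (k : nat) (b : nat * nat) : bool :=
  k * b.2 <= 4 * b.1 <= k.+1 * b.2.

Lemma dense_arraysP : all is_dense_array dense_arrays.
Proof. by vm_compute. Qed.

Lemma sparse_arraysP :
  all (fun k => all (is_sparse_array k 1) [seq t <- sparse_arrays | in_range k t.1])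
    [:: 1; 2; 3].
Proof. by vm_compute. Qed.

(** Each of these sizes is realized by an array with constant row-row numbers;
    these are the parts that are split off. *)
Definition blocks (k : nat) : seq (nat * nat) :=
  nth [::] [:: [::];
               [:: (1, 4); (6, 12)];
               [:: (6, 12); (9, 12); (9, 14); (9, 16); (9, 18)];
               [:: (9, 12); (10, 13); (11, 14); (13, 13)]] k.

Lemma blocksP :
  all (fun k => all (is_sparse_array k 0) [seq t <- sparse_arrays | t.1 \in blocks k] &&
    all [in unzip1 sparse_arrays] (blocks k)) [:: 1; 2; 3].
Proof. by vm_compute. Qed.

(** Nested conditionals instead of boolean connectives: evaluation is eager, and
    it must not enter the recursion when a test has already decided. *)
Fixpoint decomposable (n k c v : nat) : bool :=
  if ~~ in_range k (c, v) then false else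
  if (c, v) \in unzip1 sparse_arrays then true else
  if n isn't n'.+1 then false else
  has (fun b => decomposable n' k (c - b.1) (v - b.2))
    [seq b <- blocks k | (b.1 <= c) && (b.2 <= v)].

Lemma sparse_exact_block k b : 0 < k < 4 -> b \in blocks k -> sparse_exact k b.1 b.2.
Proof.
move=> k13 bk; have k123 : k \in [:: 1; 2; 3] by rewrite !inE; lia.
have := allP blocksP k k123 => /andP[exactk keys].
have {}exactk := allP exactk; have /allP/(_ b bk) := keys.
move=> /mapP[[[c v] s] tt /= bE]; subst b.
have := exactk ((c, v), s); rewrite mem_filter /= bk tt addn0 => /(_ isT) ok.
by exists (columns c s), (repetitions k c v %/ 12).
Qed.

Lemma decomposable_sparse n k c v : 0 < k < 4 -> decomposable n k c v -> sparse k c v.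
Proof.
move=> k13; have k123 : k \in [:: 1; 2; 3] by rewrite !inE; lia.
have key c' v' : in_range k (c', v') -> (c', v') \in unzip1 sparse_arrays ->
    sparse k c' v'.
  move=> inr /mapP[[[c'' v''] s] tt /= [E1 E2]]; subst c'' v''.
  have /allP/(_ (c', v', s)) := allP sparse_arraysP k k123.
  rewrite mem_filter /= inr tt addn1 => /(_ isT) ok.
  by exists (columns c' s), (repetitions k c' v' %/ 12).
elim: n c v => [|n IHn] c v /=; case: ifP => // /negbFE inr; case: ifP => //.
- by move/(key _ _ inr).
- by move/(key _ _ inr).
move=> _ /hasP[b]; rewrite mem_filter => /andP[/andP[lec lev]].
move=> /(sparse_exact_block k13) bk /IHn dec.
by rewrite -(subnKC lec) -(subnKC lev); apply: sparseD.
Qed.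

Definition exceptions : seq (nat * nat) :=
  [:: (4, 9); (5, 7); (5, 10); (6, 8); (7, 9); (10, 12); (11, 13)].

Lemma small_sizes_covered :
  all (fun c => all (fun v =>
    [|| (c, v) \in exceptions, (c, v) \in unzip1 dense_arrays
      | has (fun k => decomposable c k c v) [:: 1; 2; 3]]) (iota c (3 * c))) (iota 4 9).
Proof. by vm_compute. Qed.

(** For c >= threshold k every size in range has a column-column average of at
    most 1 and is realizable. *)
Definition threshold (k : nat) : nat := nth 0 [:: 0; 6; 9; 13] k.

(** The sizes from the threshold to its double suffice as a base for induction,
    since no block used in the induction step is larger than the threshold. *)
Lemma base_sizes_decomposable :
  all (fun k => all (fun c => all (fun v => decomposable c k c v)
      [seq v <- iota c (4 * c).+1 | in_range k (c, v)])
    (iota (threshold k) (threshold k))) [:: 1; 2; 3].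
Proof. by vm_compute. Qed.

(** Two blocks suffice for each k, one at either end of the range of v / c:
    removing the right one keeps the rest of the array in range. *)
Lemma sparse_existence k c v : 0 < k < 4 -> threshold k <= c -> c <= v ->
  in_range k (c, v) -> sparse k c v.
Proof.
move=> k13; elim/ltn_ind: c v => c IHc v le_c cv inr.
have k123 : k \in [:: 1; 2; 3] by rewrite !inE; lia.
have [lt_c2|le_c2] := ltnP c (2 * threshold k).
  have cC : c \in iota (threshold k) (threshold k) by rewrite mem_iota; lia.
  have /allP/(_ c cC)/allP/(_ v) := allP base_sizes_decomposable k k123.
  rewrite mem_filter inr mem_iota cv => /(_ _)/(decomposable_sparse k13); apply.
  by move: inr; rewrite /in_range /=; nia.
have step (b : nat * nat) : b \in blocks k -> 0 < b.1 <= threshold k -> b.2 <= v ->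
    c - b.1 <= v - b.2 -> in_range k (c - b.1, v - b.2) -> sparse k c v.
  move=> /(sparse_exact_block k13) bk b1 bv le inr'.
  have bc : b.1 <= c by lia.
  by rewrite -(subnKC bc) -(subnKC bv); apply: sparseD bk _; apply: IHc => //; lia.
move: step inr; rewrite /in_range /= => step inr.
have {k123} [k1|[k2|k3]] : k = 1 \/ k = 2 \/ k = 3 by lia.
- subst k; rewrite /threshold /= in le_c2 step.
  have [lt_v|le_v] := ltnP v (2 * c + 2).
    by apply: (step (6, 12)) => //=; lia.
  by apply: (step (1, 4)) => //=; lia.
- subst k; rewrite /threshold /= in le_c2 step.
  have [lt_v|le_v] := ltnP (3 * (v - 18)) (4 * (c - 9)).
    by apply: (step (9, 12)) => //=; lia.
  by apply: (step (9, 18)) => //=; lia.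
- subst k; rewrite /threshold /= in le_c2 step.
  have [lt_v|le_v] := ltnP v (c + 3).
    by apply: (step (13, 13)) => //=; lia.
  by apply: (step (9, 12)) => //=; lia.
Qed.

Lemma sparse_exact_single_column : sparse_exact 0 1 4.
Proof. by exists [:: [:: 0; 1; 2; 3]], 0. Qed.

Lemma sparse_exact_unused_symbol : sparse_exact 0 0 1.
Proof. by exists [::], 0. Qed.

(** The same induction with k = 0: columns of four private symbols, followed by
    unused symbols. *)
Lemma sparse_all_distinct c v : 4 * c <= v -> sparse 0 c v.
Proof.
elim: c v => [|c IHc] v le_v.
  elim: v {le_v} => [|v IHv]; first by exists [::], 0.
  exact: (sparseD sparse_exact_unused_symbol).
have -> : v = 4 + (v - 4) by lia.
by apply: (sparseD sparse_exact_single_column); apply: IHc; lia.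
Qed.

Lemma existence c v : 4 <= c -> c <= v -> (c, v) \notin exceptions ->
  exists A : row_column_design 4 c v, near_triple_array A.
Proof.
move=> c4 cv nexc; have v0 : 0 < v by lia.
have [le_v|lt_v] := leqP (4 * c) v.
  exact/(near_triple_array_of_sparse v0)/sparse_all_distinct.
have [lt_c|le_c] := ltnP c 13.
  have cC : c \in iota 4 9 by rewrite mem_iota; lia.
  have vV : v \in iota c (3 * c) by rewrite mem_iota; lia.
  have /allP/(_ v vV) := allP small_sizes_covered c cC.
  rewrite (negbTE nexc) orFb => /orP[/mapP[[[c' v'] s] ts [E1 E2]]|/hasP[k k123]].
    subst c' v'; have := allP dense_arraysP _ ts => /=.
    case: v {cv nexc vV lt_v ts} v0 => // v _ /andP[d w].
    exact: (ex_intro _ _ (near_triple_array_of_cols d w)).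
  have k13 : 0 < k < 4 by move: k123; rewrite !inE; lia.
  by move=> /(decomposable_sparse k13); apply: near_triple_array_of_sparse.
(* The quotient of 4 c by v would be 4 for v = c, which belongs to the range of
   k = 3. *)
pose k := (4 * c).-1 %/ v.
have k13 : 0 < k < 4 by rewrite /k divn_gt0 // ltn_divLR //; lia.
have inr : in_range k (c, v).
  have := leq_trunc_div (4 * c).-1 v; have := ltn_ceil (4 * c).-1 v0.
  by rewrite /in_range /= -/k; lia.
apply: (near_triple_array_of_sparse (k := k)) => //; apply: sparse_existence inr => //.
by case: k k13 => [|[|[|[|k]]]] //= _; rewrite /threshold /=; lia.
Qed.

(** * Exhaustive search over columns *)

(** A profile P lists, for the symbols 0, 1, ..., the rows that contain them, as
    bit sequences. *)
Definition profile_row (P : seq bitseq) (i : nat) : seq nat :=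
  [seq x <- iota 0 (size P) | nth false (nth [::] P x) i].

(** All columns with top entry x that agree with the profile and have
    row-column numbers between lo and hi: these numbers depend only on the
    profile. *)
Definition candidates (P : seq bitseq) (lo hi x : nat) : seq (seq nat) :=
  [seq col <- [seq x :: t | t <- [seq y :: t | y <- profile_row P 1,
       t <- [seq [:: z; w] | z <- profile_row P 2, w <- profile_row P 3]]]
   | uniq col &&
     all (fun i => lo <= count (fun y => nth false (nth [::] P y) i) col <= hi) (iota 0 4)].

Definition compatible (lo hi : nat) (x y : seq nat) : bool :=
  if all2 (fun a b => a != b) x y then lo <= common x y <= hi else false.

(** Backtracking with forward checking: a choice for the first position removes
    the incompatible options from all later positions, and it is abandoned as
    soon as one of them has no option left. The depth n only serves to make the
    recursion structural; exhausting it counts as a success, which is sound for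
    refutations. *)
Fixpoint extendable (T : Type) (R : rel T) (n : nat) (opts : seq (seq T)) : bool :=
  if opts is opt :: rest then
    if n is n'.+1 then
      has (fun x => let rest' := [seq [seq y <- l | R x y] | l <- rest] in
                    if has (@nilp _) rest' then false else extendable R n' rest') opt
    else true
  else true.

(** The columns are identified with their entries in the top row; the predicate
    first restricts the column chosen first, to break symmetries. *)
Definition search_space (P : seq bitseq) (lo hi : nat) (first : pred (seq nat)) :
    seq (seq (seq nat)) :=
  if [seq candidates P lo hi x | x <- profile_row P 0] is opt :: rest
  then filter first opt :: rest else [::].

Lemma extendable_complete (T : eqType) (R : rel T) n (opts : seq (seq T)) sol :
  size sol = size opts -> all2 (fun x l => x \in l) sol opts -> pairwise R sol ->
  extendable R n opts.
Proof.
elim: n opts sol => [|n IHn] [|opt rest] // [|x sol] //= [szs] /andP[xin solin].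
move=> /andP[Rx Rsol]; apply/hasP; exists x => //.
have sol' : all2 (fun x l => x \in l) sol [seq [seq y <- l | R x y] | l <- rest].
  elim: sol rest {IHn szs Rsol} solin Rx => [|y s IHs] [|l rest] //= /andP[yl sl] /andP[Ry Rs].
  by rewrite mem_filter Ry yl IHs.
have /negbTE -> : ~~ has (@nilp _) [seq [seq y <- l | R x y] | l <- rest].
  elim: [seq _ | _ <- _] sol sol' {IHn szs solin Rx Rsol} => [|l ls IHl] //= [|y s] //=.
  by move=> /andP[yl /IHl]; rewrite negb_or => ->; rewrite andbT; case: l yl.
by apply: IHn sol' Rsol; rewrite size_map.
Qed.

Section Profiles.
Variables (c v : nat) (A : row_column_design 4 c v).
Hypothesis binA : binary A.

(** Numbering the symbols label by label makes the list of labels depend only on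
    the number of symbols with each label. *)
Lemma exists_order (L : eqType) (lab : 'I_v -> L) (ts : seq L) :
  uniq ts -> (forall s, lab s \in ts) ->
  exists ord : seq 'I_v, [/\ uniq ord, forall s, s \in ord &
    [seq lab s | s <- ord] = flatten [seq nseq #|[set s | lab s == t]| t | t <- ts]].
Proof.
move=> uts labts; exists (flatten [seq [seq s <- enum 'I_v | lab s == t] | t <- ts]).
split.
- elim: ts uts {labts} => //= t ts IHts /andP[tts uts].
  rewrite cat_uniq filter_uniq ?enum_uniq // IHts // andbT.
  apply/hasPn => s /flatten_mapP[t' t'ts]; rewrite !mem_filter => /andP[/eqP E _].
  by apply: contra tts => /andP[/eqP <- _]; rewrite E.
- move=> s; apply/flatten_mapP; exists (lab s); rewrite ?labts //.
  by rewrite mem_filter eqxx mem_enum.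
rewrite map_flatten -map_comp; congr flatten; apply: eq_map => t /=.
have -> : #|[set s | lab s == t]| = size [seq s <- enum 'I_v | lab s == t].
  by rewrite cardE; congr size; rewrite enumT; apply: eq_filter => s; rewrite !inE.
elim: (enum 'I_v) => //= s e IHe; case: eqP => //= ->.
by rewrite IHe.
Qed.

(* The rows are read in the order r, and the symbols are replaced by their
   positions in ord. *)
Variables (r : {perm 'I_4}) (ord : seq 'I_v) (P : seq bitseq).
Hypotheses (uord : uniq ord) (ordT : forall s, s \in ord) (sizeP : size P = size ord).
Hypothesis profileP : forall s (i : 'I_4),
  nth false (nth [::] P (index s ord)) i = (s \in row_symbols A (r i)).

Definition ranks (j : 'I_c) : seq nat := [seq index (A (r i) j) ord | i <- enum 'I_4].

Lemma index_ord_inj : injective (index^~ ord).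
Proof. by move=> s t E; rewrite -(nth_index s (ordT s)) E nth_index. Qed.

Lemma enum_I4 : enum 'I_4 = [:: inord 0; inord 1; inord 2; inord 3].
Proof. by apply: (inj_map val_inj); rewrite val_enum_ord /= !inordK. Qed.

Lemma ranksE j : ranks j = [seq index s ord | s <- [seq A (r i) j | i <- enum 'I_4]].
Proof. by rewrite -map_comp. Qed.

Lemma uniq_column j : uniq [seq A (r i) j | i <- enum 'I_4].
Proof.
rewrite map_inj_uniq ?enum_uniq // => i i' /(binA.2) ; exact: perm_inj.
Qed.

Lemma mem_column s j : (s \in [seq A (r i) j | i <- enum 'I_4]) = (s \in col_symbols A j).
Proof.
apply/mapP/imsetP => [[i _ ->]|[i _ ->]]; first by exists (r i).
by exists (r^-1%g i); rewrite ?mem_enum ?permKV.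
Qed.

Lemma count_column (X : {set 'I_v}) j :
  count (mem X) [seq A (r i) j | i <- enum 'I_4] = #|X :&: col_symbols A j|.
Proof.
rewrite -size_filter -(card_uniqP (filter_uniq _ (uniq_column j))).
by apply: eq_card => s; rewrite mem_filter mem_column !inE.
Qed.

Lemma common_ranks j j' : common (ranks j) (ranks j') = common_cc A j j'.
Proof.
rewrite /common_cc setIC -count_column ranksE /common count_map; apply: eq_count => s /=.
rewrite -[LHS]/(index s ord \in ranks j') ranksE.
by rewrite (mem_map index_ord_inj) mem_column.
Qed.

Lemma index_profile_row s (i : 'I_4) :
  (index s ord \in profile_row P i) = (s \in row_symbols A (r i)).
Proof. by rewrite mem_filter profileP mem_iota sizeP leq0n add0n index_mem ordT !andbT. Qed.

Lemma ranks_candidate lo hi j :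
  (forall i, lo <= common_rc A i j <= hi) ->
  ranks j \in candidates P lo hi (index (A (r ord0) j) ord).
Proof.
move=> rcA; rewrite mem_filter; apply/andP; split.
  rewrite {1}ranksE (map_inj_uniq index_ord_inj) uniq_column andTb; apply/allP => k.
  rewrite mem_iota => /= k4; rewrite ranksE count_map.
  rewrite (eq_count (a2 := mem (row_symbols A (r (Ordinal k4))))) ?count_column; first exact: rcA.
  by move=> s /=; rewrite -profileP.
have inrow i : index (A (r i) j) ord \in profile_row P i.
  by rewrite index_profile_row imset_f.
have -> : ranks j = [:: index (A (r (inord 0)) j) ord; index (A (r (inord 1)) j) ord;
                        index (A (r (inord 2)) j) ord; index (A (r (inord 3)) j) ord].
  by rewrite /ranks enum_I4.
have -> : inord 0 = ord0 :> 'I_4 by apply: val_inj; rewrite /= inordK.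
apply/map_f/allpairsP; exists (index (A (r (inord 1)) j) ord, 
  [:: index (A (r (inord 2)) j) ord; index (A (r (inord 3)) j) ord]); split=> //=.
  by have := inrow (inord 1); rewrite inordK.
apply/allpairsP; exists (index (A (r (inord 2)) j) ord, index (A (r (inord 3)) j) ord).
by have := (inrow (inord 2), inrow (inord 3)); rewrite !inordK // => -[].
Qed.

(** An array leaves a trace in the search: its columns, sorted by their entries
    in the top row, are pairwise compatible candidates. *)
Lemma search_complete lo hi lo' hi' (first : pred (seq nat)) :
  (forall j j', j != j' -> lo <= common_cc A j j' <= hi) ->
  (forall i j, lo' <= common_rc A i j <= hi') ->
  (forall j, index (A (r ord0) j) ord = head 0 (profile_row P 0) -> first (ranks j)) ->
  extendable (compatible lo hi) (size P) (search_space P lo' hi' first).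
Proof.
move=> ccA rcA firstP.
have [js jsE] : exists js, [seq index (A (r ord0) j) ord | j <- js] = profile_row P 0.
  have : {subset profile_row P 0 <= profile_row P 0} by [].
  elim: {1 3}(profile_row P 0) => [|x l IHl] sub; first by exists [::].
  have [y yl|js jsE] := IHl; first by rewrite sub // inE yl orbT.
  have xP := sub x (mem_head x l).
  have : x < size ord.
    by move: xP; rewrite mem_filter mem_iota sizeP => /andP[_ /andP[]].
  move=> ltx; pose s := tnth (in_tuple ord) (Ordinal ltx).
  have sE : index s ord = x by rewrite /s (tnth_nth s) index_uniq.
  have := index_profile_row s ord0; rewrite sE xP => /esym/imsetP[j _ js0].
  by exists (j :: js); rewrite /= jsE -js0 sE.
have ujs : uniq js.
  by apply: (map_uniq (f := fun j => index (A (r ord0) j) ord)); rewrite jsE filter_uniq ?iota_uniq.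
pose sol := [seq ranks j | j <- js].
apply: (@extendable_complete _ _ _ _ sol).
- rewrite /search_space -jsE -map_comp size_map.
  by case: (js) => //= j l; rewrite !size_map.
- rewrite /search_space -jsE -map_comp /sol.
  case: (js) jsE => //= j l jl.
  rewrite mem_filter ranks_candidate ?firstP ?andbT -?jl //=.
  by elim: l {jl} => //= k l IHl; rewrite ranks_candidate.
- rewrite /sol pairwise_map; move: ujs; rewrite uniq_pairwise.
  apply: sub_pairwise => j j' /= ne; rewrite /compatible common_ranks ccA //.
  have -> // : all2 (fun a b => a != b) (ranks j) (ranks j').
  rewrite /ranks; elim: (enum 'I_4) => //= i l ->; rewrite andbT.
  by apply: contra_neq ne => /index_ord_inj /(binA.1 _).
Qed.

End Profiles.

(** The order decides which symbol of the top row is numbered first. If all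
    symbols miss at most one row, it is one that misses the second row. *)
Definition row_patterns : seq bitseq :=
  [:: [:: false; true; true; true]; [:: true; false; true; true];
      [:: true; true; false; true]; [:: true; true; true; false];
      [:: true; true; true; true];
      [:: true; true; false; false]; [:: true; false; true; false];
      [:: true; false; false; true]; [:: false; true; true; false];
      [:: false; true; false; true]; [:: false; false; true; true];
      [:: true; false; false; false]; [:: false; true; false; false];
      [:: false; false; true; false]; [:: false; false; false; true];
      [:: false; false; false; false]].

(** The fifth bit marks the symbols of a distinguished set of symbols. *)
Definition patterns : seq bitseq :=
  [seq rcons t x | t <- row_patterns, x <- [:: true; false]].

Section Patterns.
Variables (c v : nat) (A : row_column_design 4 c v).
Hypothesis binA : binary A.
Variables (r : {perm 'I_4}) (X : {set 'I_v}) (ws : seq nat) (marked : bool).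
Hypothesis repA : forall s, replication A s \in ws.
(* In the unmarked case X is empty and the fifth bit carries no information. *)
Hypothesis markedX : marked || (X == set0).

Definition pattern (s : 'I_v) : bitseq :=
  rcons [seq s \in row_symbols A (r i) | i <- enum 'I_4] (s \in X).

Definition pattern_count (t : bitseq) : nat := #|[set s | pattern s == t]|.

(** The number of rows containing a symbol is its replication, so only patterns
    with a weight in ws occur. *)
Definition live_patterns : seq bitseq :=
  [seq t <- patterns | (count id (take 4 t) \in ws) && (nth false t 4 ==> marked)].

Lemma patternE s : pattern s =
  [:: s \in row_symbols A (r (inord 0)); s \in row_symbols A (r (inord 1));
      s \in row_symbols A (r (inord 2)); s \in row_symbols A (r (inord 3)); s \in X].
Proof. by rewrite /pattern enum_I4. Qed.

Lemma nth_pattern s (i : 'I_4) : nth false (pattern s) i = (s \in row_symbols A (r i)).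
Proof.
rewrite /pattern nth_rcons size_map size_enum_ord ltn_ord (nth_map ord0) ?size_enum_ord //.
by rewrite nth_ord_enum.
Qed.

Lemma nth_pattern4 s : nth false (pattern s) 4 = (s \in X).
Proof. by rewrite patternE. Qed.

Lemma count_take_pattern s : count id (take 4 (pattern s)) = replication A s.
Proof.
rewrite replication_rows // /pattern -cats1 take_size_cat; last by rewrite size_map size_enum_ord.
rewrite count_map -sum1_count big_enum_cond -sum1_card /= big_mkcond [RHS]big_mkcond.
rewrite [RHS](reindex_inj (@perm_inj _ r)); apply: eq_bigr => i _.
by rewrite inE.
Qed.

Lemma mem_live_patterns s : pattern s \in live_patterns.
Proof.
rewrite mem_filter count_take_pattern repA nth_pattern4; apply/andP; split.
  by apply/implyP => sX; case/orP: markedX => [//|/eqP X0]; rewrite X0 inE in sX.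
have all5 (b0 b1 b2 b3 b4 : bool) : [:: b0; b1; b2; b3; b4] \in patterns.
  by case: b0; case: b1; case: b2; case: b3; case: b4.
by rewrite patternE all5.
Qed.

Lemma uniq_live_patterns : uniq live_patterns.
Proof. exact: filter_uniq. Qed.

(** The source of all linear equations for the numbers of symbols with a given
    pattern. *)
Lemma card_pattern (f : pred bitseq) :
  #|[set s | f (pattern s)]| = \sum_(t <- live_patterns) f t * pattern_count t.
Proof.
rewrite -sum1_card big_mkcond /=; under [RHS]eq_bigr do rewrite /pattern_count -sum1_card.
under [RHS]eq_bigr do rewrite big_distrr big_mkcond /=.
rewrite exchange_big /=; apply: eq_bigr => s _.
rewrite (bigD1_seq (pattern s)) ?mem_live_patterns ?uniq_live_patterns //= !inE eqxx big1 ?addn0.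
  by case: (f _).
by move=> t ne; rewrite inE eq_sym (negbTE ne).
Qed.

Lemma row_equation (i : 'I_4) :
  \sum_(t <- live_patterns) nth false t i * pattern_count t = c.
Proof.
rewrite -(card_pattern (fun t => nth false t i)) -(card_row_symbols (r i) binA).
by apply: eq_card => s; rewrite inE nth_pattern.
Qed.

Lemma rr_equation (i i' : 'I_4) :
  \sum_(t <- live_patterns) (nth false t i && nth false t i') * pattern_count t =
  common_rr A (r i) (r i').
Proof.
rewrite -(card_pattern (fun t => nth false t i && nth false t i')).
by apply: eq_card => s; rewrite !inE !nth_pattern.
Qed.

Lemma rc_equation (i : 'I_4) j : X = col_symbols A j ->
  \sum_(t <- live_patterns) (nth false t i && nth false t 4) * pattern_count t =
  common_rc A (r i) j.
Proof.
move=> XE; rewrite -(card_pattern (fun t => nth false t i && nth false t 4)).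
by apply: eq_card => s; rewrite !inE nth_pattern nth_pattern4 XE.
Qed.

Lemma mark_equation :
  \sum_(t <- live_patterns) nth false t 4 * pattern_count t = #|X|.
Proof.
rewrite -(card_pattern (fun t => nth false t 4)).
by apply: eq_card => s; rewrite !inE nth_pattern4.
Qed.

Lemma symbol_equation : \sum_(t <- live_patterns) pattern_count t = v.
Proof.
transitivity (\sum_(t <- live_patterns) predT t * pattern_count t).
  by apply: eq_bigr => t _; rewrite mul1n.
by rewrite -card_pattern -[RHS]card_ord; apply: eq_card => s; rewrite inE.
Qed.

Definition expand (ns : seq nat) : seq bitseq :=
  flatten [seq nseq p.1 p.2 | p <- zip ns live_patterns].

(** In the marked case X will be the set of symbols of a column. The hypothesis
    says that the column chosen first, the one whose top entry is the least
    symbol of the top row, is this column; then it consists of marked symbols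
    only. *)
Lemma profile_search (ns : seq nat) lo hi lo' hi' :
  [seq pattern_count t | t <- live_patterns] = ns ->
  (forall j j', j != j' -> lo <= common_cc A j j' <= hi) ->
  (forall i j, lo' <= common_rc A i j <= hi') ->
  let P := expand ns in
  (marked -> forall j, pattern (A (r ord0) j) = nth [::] P (head 0 (profile_row P 0)) ->
     col_symbols A j \subset X) ->
  extendable (compatible lo hi) (size P)
    (search_space P lo' hi' (fun col => marked ==> all (fun x => nth false (nth [::] P x) 4) col)).
Proof.
move=> nsE ccA rcA P markedP.
have [ord [uord ordT ordE]] := exists_order uniq_live_patterns mem_live_patterns.
have PE : P = [seq pattern s | s <- ord].
  have zipE (l : seq bitseq) : [seq nseq p.1 p.2 | p <- zip (map pattern_count l) l] =
      [seq nseq (pattern_count t) t | t <- l] by elim: l => //= t l ->.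
  by rewrite ordE /P /expand -nsE zipE.
have sizeP : size P = size ord by rewrite PE size_map.
have nthP s : nth [::] P (index s ord) = pattern s.
  by rewrite PE (nth_map s) ?nth_index ?index_mem.
apply: (search_complete binA (r := r) uord ordT sizeP) => //.
  by move=> s i; rewrite nthP nth_pattern.
move=> j jE; apply/implyP => /markedP/(_ j).
rewrite -jE nthP => /(_ erefl)/subsetP colX.
apply/allP => _ /mapP[i _ ->]; rewrite nthP nth_pattern4 colX //.
by apply/imsetP; exists (r i).
Qed.

End Patterns.

Lemma replication_range c v (A : row_column_design 4 c v) k :
  near_triple_array A -> k * v <= 4 * c < k.+1 * v ->
  forall s, k <= replication A s <= k.+1.
Proof.
move=> /near_triple_array_bounds[repA _ _ _] /andP[lo hi] s.
by have [? ?] := repA s; apply/andP; split; nia.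
Qed.

Lemma sum_sqr_replication c v (A : row_column_design 4 c v) k :
  (forall s, k <= replication A s <= k.+1) ->
  \sum_s replication A s ^ 2 + k * k.+1 * v = (2 * k + 1) * (4 * c).
Proof.
move=> repA; rewrite -(sum_replication A) big_distrr /=.
have -> : k * k.+1 * v = \sum_(s < v) k * k.+1 by rewrite sum_nat_const card_ord mulnC.
by rewrite -big_split; apply: eq_bigr => s _ /=; have := repA s; nia.
Qed.

(** * The five smallest exceptions *)

Definition fillable (ws : seq nat) (marked : bool) (lo hi lo' hi' : nat) (ns : seq nat) :=
  let P := expand ws marked ns in
  extendable (compatible lo hi) (size P)
    (search_space P lo' hi'
       (fun col => marked ==> all (fun x => nth false (nth [::] P x) 4) col)).
Arguments fillable : simpl never.

(** The counts are packed as an abstract function N, so that only the linear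
    equations remain visible. *)
Lemma unmarked_system c v (A : row_column_design 4 c v) (ws : seq nat) :
  binary A -> (forall s, replication A s \in ws) ->
  exists N : bitseq -> nat, let L := live_patterns ws false in
  [/\ forall i : 'I_4, \sum_(t <- L) nth false t i * N t = c,
      forall i i' : 'I_4,
        \sum_(t <- L) (nth false t i && nth false t i') * N t = common_rr A i i',
      \sum_(t <- L) N t = v
    & forall lo hi lo' hi',
        (forall j j', j != j' -> lo <= common_cc A j j' <= hi) ->
        (forall i j, lo' <= common_rc A i j <= hi') ->
        fillable ws false lo hi lo' hi' [seq N t | t <- L]].
Proof.
move=> binA repA; have unmarked : false || (set0 == set0 :> {set 'I_v}) by rewrite eqxx.
pose r : {perm 'I_4} := 1%g; exists (pattern_count A r set0); split.
- exact: (row_equation binA r repA unmarked).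
- move=> i i'; rewrite -[in RHS](perm1 i) -[in RHS](perm1 i').
  exact: (rr_equation binA r repA unmarked).
- exact: (symbol_equation binA r repA unmarked).
- move=> lo hi lo' hi' ccA rcA.
  exact: (profile_search binA (r := r) repA unmarked erefl ccA rcA).
Qed.

Notation "''o_' i" := (@Ordinal 4 i isT) (at level 8, i at level 2, format "''o_' i").

Ltac unroll_sums :=
  match goal with |- context [live_patterns ?ws ?m] =>
    let l := eval vm_compute in (live_patterns ws m) in
    change (live_patterns ws m) with l
  end; rewrite !big_cons !big_nil /=.

(** Replaces the list of counts by its numerical value l, which the equations in
    the context determine. *)
Ltac counts l :=
  match goal with |- context [fillable _ _ _ _ _ _ ?ns] =>
    have -> : ns = l by repeat (congr cons; first lia)
  end.

(** The six row-row numbers are 1 or 2 and add up to 7. The pair of rows with two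
    common symbols determines all the counts. *)
Lemma no_4_9 (A : row_column_design 4 4 9) : ~ near_triple_array A.
Proof.
move=> nta; have binA : binary A by case: nta.
have repA := replication_range (k := 1) nta isT.
have := sum_sqr_replication repA.
have [_ rrA ccA rcA] := near_triple_array_bounds nta.
move: (\sum_s _) rrA ccA rcA => S rrA ccA rcA /= SE.
have {SE} SE : S = 30 by lia.
have {}ccA j j' : j != j' -> 1 <= common_cc A j j' <= 2 by move=> /ccA; lia.
have {}rcA i j : 1 <= common_rc A i j <= 2 by have := rcA i j; lia.
have {}rrA i i' : i != i' -> 1 <= common_rr A i i' <= 2 by move=> /rrA; lia.
have {}repA s : replication A s \in [:: 1; 2] by rewrite !inE; have := repA s; lia.
have [N [rowE rrE totE search]] := unmarked_system binA repA.
have := (search _ _ _ _ ccA rcA, (rrA 'o_0 'o_1 isT, rrA 'o_0 'o_2 isT,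
  rrA 'o_0 'o_3 isT, rrA 'o_1 'o_2 isT, rrA 'o_1 'o_3 isT, rrA 'o_2 'o_3 isT)).
rewrite -!rrE; move: (rowE 'o_0) (rowE 'o_1) (rowE 'o_2) (rowE 'o_3) totE.
move=> {rowE rrE search rrA ccA rcA repA SE S nta binA}.
unroll_sums; do 10!move: (N _).
move=> s3 s2 s1 s0 d23 d13 d12 d03 d02 d01 r0 r1 r2 r3 tot [search rr].
move: search; have [[[[[? ?] ?] ?] ?] ?] := rr.
have [e|[e|[e|[e|[e|e]]]]] :
    d01 = 2 \/ d02 = 2 \/ d03 = 2 \/ d12 = 2 \/ d13 = 2 \/ d23 = 2 by lia.
- by counts [:: 2; 1; 1; 1; 1; 1; 0; 0; 1; 1]; vm_compute.
- by counts [:: 1; 2; 1; 1; 1; 1; 0; 1; 0; 1]; vm_compute.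
- by counts [:: 1; 1; 2; 1; 1; 1; 0; 1; 1; 0]; vm_compute.
- by counts [:: 1; 1; 1; 2; 1; 1; 1; 0; 0; 1]; vm_compute.
- by counts [:: 1; 1; 1; 1; 2; 1; 1; 0; 1; 0]; vm_compute.
- by counts [:: 1; 1; 1; 1; 1; 2; 1; 1; 0; 0]; vm_compute.
Qed.

(** All symbols occur twice, so a row has five common symbols with the three
    other rows, 1 + 2 + 2: the pairs of rows with a single common symbol form a
    perfect matching. *)
Lemma no_5_10 (A : row_column_design 4 5 10) : ~ near_triple_array A.
Proof.
move=> nta; have binA : binary A by case: nta.
have repA := replication_range (k := 2) nta isT.
have := sum_sqr_replication repA.
have [rep2 rrA ccA rcA] := near_triple_array_bounds nta.
move: (\sum_s _) rrA ccA rcA => S rrA ccA rcA /= SE.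
have {SE} SE : S = 40 by lia.
have {}ccA j j' : j != j' -> 1 <= common_cc A j j' <= 1 by move=> /ccA; lia.
have {}rcA i j : 2 <= common_rc A i j <= 2 by have := rcA i j; lia.
have {}rrA i i' : i != i' -> 1 <= common_rr A i i' <= 2 by move=> /rrA; lia.
have {}repA s : replication A s \in [:: 2] by rewrite !inE; have := rep2 s; lia.
have [N [rowE rrE totE search]] := unmarked_system binA repA.
have := (search _ _ _ _ ccA rcA, (rrA 'o_0 'o_1 isT, rrA 'o_0 'o_2 isT,
  rrA 'o_0 'o_3 isT, rrA 'o_1 'o_2 isT, rrA 'o_1 'o_3 isT, rrA 'o_2 'o_3 isT)).
rewrite -!rrE; move: (rowE 'o_0) (rowE 'o_1) (rowE 'o_2) (rowE 'o_3) totE.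
move=> {rowE rrE search rrA ccA rcA repA rep2 SE S nta binA}.
unroll_sums; do 6!move: (N _).
move=> d23 d13 d12 d03 d02 d01 r0 r1 r2 r3 tot [search rr].
move: search; have [[[[[? ?] ?] ?] ?] ?] := rr.
(* The pair of rows 0 and i with a single common symbol determines the matching. *)
have [e|[e|e]] : d01 = 1 \/ d02 = 1 \/ d03 = 1 by lia.
- by counts [:: 1; 2; 2; 2; 2; 1]; vm_compute.
- by counts [:: 2; 1; 2; 2; 1; 2]; vm_compute.
- by counts [:: 2; 2; 1; 1; 2; 2]; vm_compute.
Qed.

(** One symbol occurs twice, the others three times. The two rows of the former
    determine all the counts, because every row misses exactly two symbols. *)
Lemma no_5_7 (A : row_column_design 4 5 7) : ~ near_triple_array A.
Proof.
move=> nta; have binA : binary A by case: nta.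
have repA := replication_range (k := 2) nta isT.
have := sum_sqr_replication repA.
have [_ _ ccA rcA] := near_triple_array_bounds nta.
move: (\sum_s _) ccA rcA => S ccA rcA /= SE.
have {SE} SE : S = 58 by lia.
have {}ccA j j' : j != j' -> 1 <= common_cc A j j' <= 2 by move=> /ccA; lia.
have {}rcA i j : 2 <= common_rc A i j <= 3 by have := rcA i j; lia.
have {}repA s : replication A s \in [:: 2; 3] by rewrite !inE; have := repA s; lia.
have [N [rowE _ totE search]] := unmarked_system binA repA.
move: (rowE 'o_0) (rowE 'o_1) (rowE 'o_2) (rowE 'o_3) totE (search _ _ _ _ ccA rcA).
move=> {rowE search ccA rcA repA SE S nta binA}.
unroll_sums; do 10!move: (N _).
move=> d23 d13 d12 d03 d02 d01 t3 t2 t1 t0 r0 r1 r2 r3 tot.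
have [e|[e|[e|[e|[e|e]]]]] :
    d01 = 1 \/ d02 = 1 \/ d03 = 1 \/ d12 = 1 \/ d13 = 1 \/ d23 = 1 by lia.
- by counts [:: 2; 2; 1; 1; 1; 0; 0; 0; 0; 0]; vm_compute.
- by counts [:: 2; 1; 2; 1; 0; 1; 0; 0; 0; 0]; vm_compute.
- by counts [:: 2; 1; 1; 2; 0; 0; 1; 0; 0; 0]; vm_compute.
- by counts [:: 1; 2; 2; 1; 0; 0; 0; 1; 0; 0]; vm_compute.
- by counts [:: 1; 2; 1; 2; 0; 0; 0; 0; 1; 0]; vm_compute.
- by counts [:: 1; 1; 2; 2; 0; 0; 0; 0; 0; 1]; vm_compute.
Qed.

(** Suppose that all symbols of the column j0 occur three times. A row shares at
    least three symbols with j0, so the four symbols of j0 are missing from four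
    different rows. Every row misses exactly two symbols, hence one of j0 and one
    other. This determines all the counts when the symbols of j0 are marked.
    Exchanging two rows, one may assume that the top symbol of j0 is missing from
    the second row; then j0 is the column chosen first by the search, and
    marking it has removed most of the symmetry. *)
Lemma free_column_system c (A : row_column_design 4 c c.+2) (j0 : 'I_c) :
  binary A -> (forall s, replication A s \in [:: 3; 4]) ->
  (forall j j', j != j' -> 1 <= common_cc A j j' <= 2) ->
  (forall i j, 3 <= common_rc A i j <= 4) ->
  (forall s, s \in col_symbols A j0 -> replication A s = 3) ->
  fillable [:: 3; 4] true 1 2 3 4 [:: 1; 1; 1; 1; 1; 1; 1; 1; 0; c - 6].
Proof.
move=> binA repA ccA rcA free.
have miss_le1 i s t : s \in col_symbols A j0 -> t \in col_symbols A j0 ->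
    s \notin row_symbols A i -> t \notin row_symbols A i -> s = t.
  move=> sj tj si ti; apply/eqP; apply: contraT => st.
  have := card_col_symbols j0 binA.
  rewrite -(cardsID (row_symbols A i)) setIC -/(common_rc A i j0).
  have : 1 < #|col_symbols A j0 :\: row_symbols A i|.
    by apply/card_gt1P; exists s, t; rewrite !inE si ti sj tj.
  by have := rcA i j0; lia.
pose s0 := A ord0 j0; have s0j : s0 \in col_symbols A j0 by apply/imsetP; exists ord0.
have s0r : s0 \in row_symbols A ord0 by apply/imsetP; exists j0.
have [h s0h] : exists h, s0 \notin row_symbols A h.
  apply/existsP; apply: contraT => /existsPn all_rows.
  have := free s0 s0j; rewrite replication_rows //.
  have -> : [set i | s0 \in row_symbols A i] = setT.
    by apply/setP => i; rewrite !inE; have := all_rows i; rewrite negbK.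
  by rewrite cardsT card_ord.
have h0 : h != ord0 by apply: contraNneq s0h => ->.
pose r := tperm 'o_1 h.
have r0 : r ord0 = ord0 by rewrite tpermD // eq_sym.
have r1 : r 'o_1 = h by rewrite tpermL.
pose X := col_symbols A j0; have marked : true || (X == set0) by [].
have := profile_search binA (r := r) repA marked erefl ccA rcA.
suff -> : [seq pattern_count A r X t | t <- live_patterns [:: 3; 4] true] =
          [:: 1; 1; 1; 1; 1; 1; 1; 1; 0; c - 6].
  apply=> _ j.
  have -> : nth [::] (expand [:: 3; 4] true [:: 1; 1; 1; 1; 1; 1; 1; 1; 0; c - 6])
      (head 0 (profile_row (expand [:: 3; 4] true [:: 1; 1; 1; 1; 1; 1; 1; 1; 0; c - 6]) 0)) =
      [:: true; false; true; true; true] by [].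
  rewrite r0 => patE.
  have sX : A ord0 j \in X by rewrite -(nth_pattern4 A r X) patE.
  have sh : A ord0 j \notin row_symbols A h.
    by rewrite -r1 -(nth_pattern A r X) patE.
  suff -> : j = j0 by [].
  by apply: (binA.1 ord0); apply: miss_le1 sh s0h.
have full0 : pattern_count A r X [:: true; true; true; true; true] = 0.
  apply/eqP; rewrite cards_eq0; apply/eqP/setP => s; rewrite !inE; apply/negP => /eqP patE.
  have := free s; rewrite -(count_take_pattern binA r X) patE -[_ \in _]/(s \in X).
  by rewrite -(nth_pattern4 A r) patE => /(_ isT).
have rowE := row_equation binA r repA marked; have totE := symbol_equation binA r repA marked.
have markE := mark_equation binA r repA marked.
have rcE i : 3 <= \sum_(t <- live_patterns [:: 3; 4] true)
    (nth false t (i : 'I_4) && nth false t 4) * pattern_count A r X t <= 4.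
  by rewrite (rc_equation binA r repA marked i (erefl X)).
move: (rowE 'o_0) (rowE 'o_1) (rowE 'o_2) (rowE 'o_3) totE markE full0.
move: (rcE 'o_0) (rcE 'o_1) (rcE 'o_2) (rcE 'o_3); rewrite card_col_symbols //.
move: (pattern_count A r X) => N {rowE rcE}.
unroll_sums; do 10!move: (N _).
move=> q q' m0 m0' m1 m1' m2 m2' m3 m3'.
move=> *; repeat (congr cons; first by lia); by [].
Qed.

Lemma sum_heavy c v (A : row_column_design 4 c v) :
  (forall s, 3 <= replication A s <= 4) ->
  \sum_s (replication A s == 4 : nat) + 3 * v = 4 * c.
Proof.
move=> repA; rewrite -(sum_replication A).
have -> : 3 * v = \sum_(s < v) 3 by rewrite sum_nat_const card_ord mulnC.
rewrite -big_split; apply: eq_bigr => s _ /=.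
by have := repA s; case: (replication A s) => [|[|[|[|[|k]]]]].
Qed.

Lemma no_6_8 (A : row_column_design 4 6 8) : ~ near_triple_array A.
Proof.
move=> nta; have binA : binary A by case: nta.
have repA := replication_range (k := 3) nta isT.
have := sum_sqr_replication repA.
have [rep3 _ ccA rcA] := near_triple_array_bounds nta.
move: (\sum_s _) ccA rcA => S ccA rcA /= SE.
have {SE} SE : S = 72 by lia.
have {}ccA j j' : j != j' -> 1 <= common_cc A j j' <= 2 by move=> /ccA; lia.
have {}rcA i j : 3 <= common_rc A i j <= 4 by have := rcA i j; lia.
have {}rep3 s : replication A s = 3 by have := rep3 s; lia.
have {}repA s : replication A s \in [:: 3; 4] by rewrite rep3.
have := @free_column_system 6 A ord0 binA repA ccA rcA (fun s _ => rep3 s).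
by vm_compute.
Qed.

(** Only one symbol occurs four times, so some column avoids it. *)
Lemma no_7_9 (A : row_column_design 4 7 9) : ~ near_triple_array A.
Proof.
move=> nta; have binA : binary A by case: nta.
have repA := replication_range (k := 3) nta isT.
have := sum_sqr_replication repA.
have [_ _ ccA rcA] := near_triple_array_bounds nta.
move: (\sum_s _) ccA rcA => S ccA rcA /= SE.
have {SE} SE : S = 88 by lia.
have {}ccA j j' : j != j' -> 1 <= common_cc A j j' <= 2 by move=> /ccA; lia.
have {}rcA i j : 3 <= common_rc A i j <= 4 by have := rcA i j; lia.
have [j0 free] : exists j0 : 'I_7, [forall s, (s \in col_symbols A j0) ==> (replication A s == 3)].
  apply/existsP; apply: contraT => /existsPn none.
  have : \sum_(j < 7) 1 <= \sum_j \sum_s (replication A s == 4) * (s \in col_symbols A j).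
    apply: leq_sum => j _; have := none j; rewrite negb_forall => /existsP[s].
    rewrite negb_imply (bigD1 s) //= => /andP[-> s3].
    by have := repA s; case: eqP => //; lia.
  rewrite exchange_big sum_nat_const card_ord /=.
  under eq_bigr => s _.
    rewrite -big_distrr /=.
    have -> : \sum_j (s \in col_symbols A j) = replication A s.
      rewrite replication_cols // -sum1_card [RHS]big_mkcond.
      by apply: eq_bigr => j _; rewrite inE; case: (_ \in _).
    have -> : (replication A s == 4) * replication A s = (replication A s == 4) * 4.
      by case: eqP => [->|].
    over.
  rewrite -big_distrl /=; have := sum_heavy repA; move: (\sum_s _) => h; lia.
have {}repA s : replication A s \in [:: 3; 4] by rewrite !inE; have := repA s; lia.
have {}free s : s \in col_symbols A j0 -> replication A s = 3.
  by move=> sj; have /forallP/(_ s)/implyP/(_ sj)/eqP := free.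
have := free_column_system binA repA ccA rcA free.
by vm_compute.
Qed.

(** * The exceptions (10, 12) and (11, 13) *)

(** Only the incidence b between symbols and columns matters here; q is the set
    of heavy symbols. *)
Section Incidence.
Variables (V C : finType) (b : V -> C -> bool) (q : pred V).

Definition meet (j j' : C) : nat := \sum_s b s j * b s j'.
Definition weight (j : C) : nat := \sum_s q s * b s j.

Hypothesis col_size : forall j, \sum_s b s j = 4.
Hypothesis degree : forall s, \sum_j b s j = 3 + q s.

Lemma meetC j j' : meet j j' = meet j' j.
Proof. by apply: eq_bigr => s _; rewrite mulnC. Qed.

Lemma meet_ge2 s s' j j' : s != s' -> b s j -> b s j' -> b s' j -> b s' j' ->
  2 <= meet j j'.
Proof.
move=> ne bj bj' bj2 bj2'; rewrite /meet (bigD1 s) // (bigD1 s') 1?eq_sym //=.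
by rewrite bj bj' bj2 bj2'.
Qed.

Lemma sum_light j : \sum_s ~~ q s * b s j + weight j = 4.
Proof.
rewrite -(col_size j) -big_split; apply: eq_bigr => s _ /=.
by case: (q s); rewrite ?mul1n ?mul0n ?addn0.
Qed.

Lemma weight_le4 j : weight j <= 4.
Proof.
by rewrite -(col_size j); apply: leq_sum => s _; case: (q s); rewrite ?mul1n.
Qed.

(** Each symbol of j occurs 2 or 3 more times, the latter if it is heavy. *)
Lemma sum_meet j : \sum_(j' | j' != j) meet j j' = 8 + weight j.
Proof.
have total : \sum_j' meet j j' = 12 + weight j.
  rewrite exchange_big -[12]/(4 * 3) -(col_size j) big_distrl -big_split /=.
  apply: eq_bigr => s _; rewrite -big_distrr /= degree mulnDr.
  by rewrite [q s * _]mulnC.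
have meetjj : meet j j = 4.
  by rewrite -(col_size j); apply: eq_bigr => s _; case: (b s j).
by move: total; rewrite (bigD1 j) //=; lia.
Qed.

Lemma sum_weight : \sum_j weight j = \sum_s q s * 4.
Proof.
rewrite exchange_big; apply: eq_bigr => s _; rewrite -big_distrr /= degree.
by case: (q s).
Qed.

Definition overlap (s s' : V) : nat := \sum_j b s j * b s' j.

Lemma sum_overlap_heavy s : \sum_s' q s' * overlap s s' = \sum_j b s j * weight j.
Proof.
under eq_bigr do rewrite big_distrr; rewrite exchange_big /=.
apply: eq_bigr => j _; rewrite big_distrr /=; apply: eq_bigr => s' _.
by rewrite mulnCA mulnA.
Qed.

Lemma overlapE s s' : overlap s s' = #|[set j | b s j && b s' j]|.
Proof.
rewrite -sum1_card big_mkcond; apply: eq_bigr => j _.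
by rewrite inE mulnb; case: (_ && _).
Qed.

Lemma overlap_le1 s s' : s != s' -> (forall j j', j != j' -> meet j j' <= 1) ->
  overlap s s' <= 1.
Proof.
move=> ne meet1; rewrite leqNgt overlapE; apply/negP => /card_gt1P[j [j' []]].
rewrite !inE => /andP[b1 b2] /andP[b3 b4] nej.
by have := meet_ge2 ne b1 b3 b2 b4; have := meet1 j j' nej; lia.
Qed.

(** A light symbol with w = 2 in its three columns would share a column with six
    heavy symbols, but there are only five and each is met at most once. So every
    light symbol has a column of weight at most 1. A column of weight w <= 1 has
    4 - w <= 3 (2 - w) light symbols, and the sum of 3 (2 - w) is 66 - 60 < 8. *)
Lemma no_incidence_11_13 :
  #|C| = 11 -> \sum_s q s = 5 -> \sum_s ~~ q s = 8 ->
  (forall j j', j != j' -> meet j j' <= 1) -> False.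
Proof.
move=> cardC heavy5 light8 meet1.
have weight2 j : weight j <= 2.
  have : 8 + weight j <= \sum_(j' | j' != j) 1.
    by rewrite -sum_meet; apply: leq_sum => j' ne; rewrite meet1 // eq_sym.
  by rewrite sum1_card cardC1 cardC; lia.
have weights : \sum_j weight j = 20 by rewrite sum_weight -big_distrl /= heavy5.
have deficient s : ~~ q s -> 1 <= \sum_j b s j * (weight j <= 1).
  move=> qs; rewrite leqNgt ltnS leqn0; apply/negP => none.
  have full j : b s j -> weight j = 2.
    move=> bsj; move: none; rewrite sum_nat_eq0 => /forallP/(_ j).
    by rewrite bsj /= mul1n eqb0 -ltnNge; have := weight2 j; lia.
  have : \sum_s' q s' * overlap s s' <= \sum_s' q s'.
    apply: leq_sum => s' _; have [<-|ne] := eqVneq s s'; first by rewrite (negbTE qs).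
    by rewrite -[X in _ <= X]muln1 leq_mul2l overlap_le1 ?orbT.
  rewrite sum_overlap_heavy heavy5.
  have -> : \sum_j b s j * weight j = \sum_j b s j * 2.
    by apply: eq_bigr => j _; case E: (b s j); rewrite ?mul0n ?full.
  by rewrite -big_distrl /= degree (negbTE qs).
have : 8 <= \sum_s ~~ q s * \sum_j b s j * (weight j <= 1).
  rewrite -light8; apply: leq_sum => s _.
  by case E: (q s) => //=; rewrite mul1n deficient ?E.
have -> : \sum_s ~~ q s * \sum_j b s j * (weight j <= 1) =
          \sum_j (4 - weight j) * (weight j <= 1).
  under eq_bigr do rewrite big_distrr; rewrite exchange_big /=.
  apply: eq_bigr => j _; have <- : \sum_s ~~ q s * b s j = 4 - weight j.
    by have := sum_light j; lia.
  by rewrite big_distrl; apply: eq_bigr => s _ /=; rewrite mulnA.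
have : \sum_j ((4 - weight j) * (weight j <= 1) + 3 * weight j) <= \sum_(j : C) 6.
  by apply: leq_sum => j _; have := weight2 j; case: (weight j) => [|[|[|]]].
rewrite big_split /= -big_distrr /= weights sum_nat_const cardC; lia.
Qed.

Section TenColumns.
Hypotheses (cardC : #|C| = 10) (heavy4 : \sum_s q s = 4) (light8 : \sum_s ~~ q s = 8).
Hypothesis meet12 : forall j j', j != j' -> 1 <= meet j j' <= 2.

Lemma card_others (j : C) : #|[pred j' | j' != j]| = 9.
Proof. by rewrite -[9]/(10.-1) -cardC -(cardC1 j); apply: eq_card. Qed.

(** Call meet j j' - 1 the excess of j and j'. Nine of the 8 + w(j) common symbols
    of j and the other nine columns are not excess. *)
Lemma sum_excess j : \sum_(j' | j' != j) (meet j j').-1 + 1 = weight j.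
Proof.
have : \sum_(j' | j' != j) ((meet j j').-1 + 1) = 8 + weight j.
  rewrite -sum_meet; apply: eq_bigr => j' ne.
  by have := meet12 (j := j) (j' := j'); rewrite eq_sym ne => /(_ isT); lia.
by rewrite big_split /= sum1_card card_others; lia.
Qed.

Lemma weight_gt0 j : 0 < weight j.
Proof. by rewrite -sum_excess addn1. Qed.

Lemma weights : \sum_j weight j = 16.
Proof. by rewrite sum_weight -big_distrl /= heavy4. Qed.

(** Let n be the number of common columns of a heavy and a light symbol. Summing
    2 n <= 2 + n (n - 1) over the 32 such pairs gives a contradiction if all
    weights are 1 or 2: the left hand side is twice the sum of w (4 - w), that is
    72; on the right, n (n - 1) counts pairs of columns sharing both a heavy and a
    light symbol, which have excess 1, and the excesses add up to 6. *)
Lemma exists_weight_ge3 : exists j, 3 <= weight j.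
Proof.
have [/existsP //|/existsPn small] := boolP [exists j, 3 <= weight j].
exfalso.
have weight12 j : weight j = 1 \/ weight j = 2.
  by have := small j; have := weight_gt0 j; lia.
pose pairs s s' := \sum_j \sum_(j' | j' != j) (b s j * b s j') * (b s' j * b s' j').
have overlap_pairs s s' : 2 * overlap s s' <= 2 + pairs s s'.
  have -> : pairs s s' = overlap s s' * (overlap s s').-1.
    rewrite {2}overlapE; set X := [set j | _].
    transitivity (\sum_j (b s j * b s' j) * #|X|.-1); last by rewrite -big_distrl.
    apply: eq_bigr => j _; case bj: (b s j && b s' j); last first.
      have -> : b s j * b s' j = 0 by rewrite mulnb bj.
      by rewrite big1 // => j' _; rewrite mulnACA mulnb bj.
    have [bj1 bj2] := andP bj; rewrite bj1 bj2 mul1n.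
    have jX : j \in X by rewrite inE.
    rewrite (cardsD1 j X) jX /= -sum1_card [RHS]big_mkcond [LHS]big_mkcond.
    apply: eq_bigr => j' _; rewrite !inE; case: (j' == j) => //=.
    by rewrite !mul1n mulnb; case: (_ && _).
  by case: (overlap s s') => [|[|[|k]]] //=; nia.
have : \sum_s ~~ q s * \sum_s' q s' * (2 * overlap s s') = 72.
  transitivity (2 * \sum_j (4 - weight j) * weight j).
    under eq_bigr => s _.
      have -> : \sum_s' q s' * (2 * overlap s s') = 2 * \sum_j b s j * weight j.
        by rewrite -sum_overlap_heavy big_distrr; apply: eq_bigr => s' _; rewrite mulnCA.
      over.
    under eq_bigr do rewrite mulnCA; rewrite -big_distrr; congr (2 * _).
    under eq_bigr do rewrite big_distrr; rewrite exchange_big /=.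
    apply: eq_bigr => j _; have <- : \sum_s ~~ q s * b s j = 4 - weight j.
      by have := sum_light j; lia.
    by rewrite big_distrl; apply: eq_bigr => s _; rewrite /= mulnA.
  have -> : \sum_j (4 - weight j) * weight j = \sum_j (2 + weight j).
    by apply: eq_bigr => j _; case: (weight12 j) => ->.
  by rewrite big_split /= weights sum_nat_const cardC.
have : \sum_s ~~ q s * \sum_s' q s' * (2 * overlap s s') <=
       \sum_s ~~ q s * \sum_s' q s' * (2 + pairs s s').
  by apply: leq_sum => s _; rewrite leq_mul2l; apply/orP; right;
     apply: leq_sum => s' _; rewrite leq_mul2l overlap_pairs orbT.
have -> : \sum_s ~~ q s * \sum_s' q s' * (2 + pairs s s') =
    64 + \sum_s ~~ q s * \sum_s' q s' * pairs s s'.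
  have -> : 64 = \sum_s ~~ q s * \sum_s' q s' * 2.
    by rewrite -big_distrl /= -big_distrl /= light8 heavy4.
  rewrite -big_split; apply: eq_bigr => s _ /=; rewrite -mulnDr -big_split.
  by congr (_ * _); apply: eq_bigr => s' _ /=; rewrite mulnDr.
suff : \sum_s ~~ q s * \sum_s' q s' * pairs s s' <= 6 by lia.
have -> : 6 = \sum_j \sum_(j' | j' != j) (meet j j').-1.
  have : \sum_j (\sum_(j' | j' != j) (meet j j').-1 + 1) = 16.
    by rewrite -weights; apply: eq_bigr => j _; rewrite sum_excess.
  by rewrite big_split /= sum1_card cardC; lia.
under eq_bigr do rewrite big_distrr /=.
have -> : \sum_s \sum_s' ~~ q s * (q s' * pairs s s') =
  \sum_j \sum_(j' | j' != j)
    (\sum_s ~~ q s * (b s j * b s j')) * (\sum_s' q s' * (b s' j * b s' j')).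
  under [RHS]eq_bigr => j _ do under eq_bigr => j' _ do rewrite big_distrlr /=.
  under [RHS]eq_bigr => j _ do rewrite exchange_big /=.
  rewrite [RHS]exchange_big /=; apply: eq_bigr => s _.
  under [RHS]eq_bigr => j _ do rewrite exchange_big /=.
  rewrite [RHS]exchange_big /=; apply: eq_bigr => s' _.
  rewrite mulnA big_distrr /=; apply: eq_bigr => j _; rewrite big_distrr /=.
  by apply: eq_bigr => j' _; rewrite mulnACA.
apply: leq_sum => j _; apply: leq_sum => j' ne.
set m := \sum_s _; set n := \sum_s' _.
have : meet j j' = m + n.
  rewrite /meet -big_split; apply: eq_bigr => s _ /=.
  by case: (q s); rewrite ?mul1n ?mul0n ?addn0.
have := meet12 (j := j) (j' := j'); rewrite eq_sym ne => /(_ isT).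
by clear; case: m n => [|[|[|m]]] [|[|[|n]]] //=; lia.
Qed.

Lemma excess_pair j k l : k != j -> l != j -> k != l ->
  (meet j k).-1 + (meet j l).-1 < weight j.
Proof.
move=> kj lj kl; rewrite -sum_excess addn1 ltnS (bigD1 k) //= (bigD1 l) //=.
  by rewrite addnA leq_addr.
by rewrite lj eq_sym.
Qed.

(** Let t be the light symbol of p, and u the heavy symbol not in p. A column
    y <> p of t shares with p the symbol t and its heavy symbols other than u, so
    the excess of y and p is w(y), or w(y) - 1 if u is in y. The total excess at
    y is w(y) - 1; hence u is in y, and y has no excess with the third column z
    of t. By symmetry u is in z, and then y and z share both t and u. *)
Lemma weight_neq3 p : weight p != 3.
Proof.
have arith (e : bool) k l w : 1 + w <= k + e -> k.-1 + l.-1 < w ->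
    1 <= k <= 2 -> 1 <= l <= 2 -> e && (l == 1) by case: e; lia.
apply/eqP => wp.
have [t /andP[qt btp]] : exists t, ~~ q t && b t p.
  apply/existsP; apply: contraT => /existsPn none.
  have : \sum_s ~~ q s * b s p = 0.
    by apply: big1 => s _; have := none s; case: (q s); case: (b s p).
  by have := sum_light p; lia.
have [u /andP[qu bup]] : exists u, q u && ~~ b u p.
  apply/existsP; apply: contraT => /existsPn none.
  have : \sum_s q s = weight p; last by rewrite heavy4 wp.
  by apply: eq_bigr => s _; have := none s; case: (q s); case: (b s p).
have only_u s : q s -> ~~ b s p -> s = u.
  move=> qs bs; apply/eqP; apply: contraT => ne.
  have : \sum_s (q s * ~~ b s p + q s * b s p) = 4.
    by rewrite -heavy4; apply: eq_bigr => s' _; case: (q s'); case: (b s' p).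
  rewrite big_split /= -[X in _ + X = _]/(weight p) wp.
  by rewrite (bigD1 s) // (bigD1 u) 1?eq_sym //= qs bs qu bup; lia.
have tu : t != u by apply: contraNneq qt => ->.
have in_u y z : y != p -> z != p -> y != z -> b t y -> b t z ->
    b u y && (meet y z == 1).
  move=> yp zp yz ty tz.
  have : 1 + weight y <= meet y p + b u y.
    rewrite /meet (bigD1 t) //= ty btp muln1 -addnA leq_add2l.
    have -> : weight y = \sum_(s | s != t) q s * b s y.
      by rewrite /weight (bigD1 t) //= (negbTE qt).
    rewrite (bigD1 u) 1?eq_sym //= [X in _ <= X + _](bigD1 u) 1?eq_sym //=.
    rewrite (negbTE bup) muln0 qu mul1n add0n addnC leq_add2r.
    apply: leq_sum => s /andP[_ su]; case qs: (q s) => //; rewrite mul1n.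
    suff -> : b s p by rewrite muln1.
    by apply: contraNT su => /(only_u s qs) ->.
  have := @excess_pair y p z.
  rewrite [p == y]eq_sym [z == y]eq_sym [p == z]eq_sym yp yz zp => /(_ isT isT isT).
  by move: (meet12 yz) (meet12 yp) => mz mp lt_y le_y; apply: arith le_y lt_y mp mz.
have := degree t; rewrite (negbTE qt) addn0.
have <- : #|[set j | b t j]| = \sum_j b t j.
  by rewrite -sum1_card big_mkcond; apply: eq_bigr => j _; rewrite inE; case: (b t j).
rewrite (cardsD1 p) inE btp add1n => -[] /eqP/cards2P[y [z [yz E]]].
have : y \in [set j | b t j] :\ p by rewrite E !inE eqxx.
have : z \in [set j | b t j] :\ p by rewrite E !inE eqxx orbT.
rewrite !inE => /andP[zp tz] /andP[yp ty].
have /andP[uy /eqP m1] := in_u y z yp zp yz ty tz.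
have /andP[uz _] : b u z && (meet z y == 1) by apply: in_u => //; rewrite eq_sym.
by have := meet_ge2 tu ty tz uy uz; rewrite m1.
Qed.

(** m h s says that the symbol s is missing from the row h. *)
Section RowClasses.
Variable m : 'I_4 -> V -> bool.
Hypothesis one_row : forall s, \sum_h m h s = ~~ q s.
Hypothesis two_symbols : forall h, \sum_s m h s = 2.
Hypothesis disjoint_columns : forall h j, \sum_s m h s * b s j <= 1.

(** The heavy symbols are the symbols of p, and the columns other than p pairwise
    share exactly one symbol. For a row h, let u_h be the indicator function of
    the columns avoiding the two symbols missing from h; there are three of them
    besides p. For any other symbol s, the number n_h(s) of these columns that
    contain s is at least 1, since s meets either missing symbol at most once.
    The sums of n_h and of its square over these ten symbols are 12 and 18. If
    n_h only took the values 1 and 2, the second sum would be 3 * 12 - 2 * 10, so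
    some symbol contains all three columns. It cannot be light: the other symbol missing from
    its row would contain none of the three. Hence the sum of n_h over the heavy
    symbols is at least 3 + 1 + 1 + 1, and at least 24 in total for all rows. But
    w(j) rows have j among their three columns, so this total is the sum of
    w(j)^2 over j <> p, which is 18. *)
Lemma weight_neq4 p : weight p != 4.
Proof.
apply/eqP => wp.
have heavy_p s : b s p = q s.
  have /eqP : \sum_s (q s * ~~ b s p + ~~ q s * b s p) = 0.
    have := sum_light p; rewrite wp => light0.
    have light1 : \sum_s ~~ q s * b s p = 0 by lia.
    have : \sum_s (q s * ~~ b s p + q s * b s p) = 4.
      by rewrite -heavy4; apply: eq_bigr => s' _; case: (q s'); case: (b s' p).
    by rewrite !big_split /= light1 -[X in _ + X = _]/(weight p) wp; lia.
  by rewrite sum_nat_eq0 => /forallP/(_ s); case: (q s); case: (b s p).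
have meetp j : meet p j = weight j.
  by apply: eq_bigr => s _; rewrite heavy_p.
have weight12 j : j != p -> 1 <= weight j <= 2.
  by move=> jp; rewrite -meetp meet12 // eq_sym.
have weights9 : \sum_(j | j != p) weight j = 12.
  by have := weights; rewrite (bigD1 p) //= wp; lia.
have card9 : \sum_(j : C | j != p) 1 = 9 by rewrite sum1_card card_others.
(* The excesses at j and at p leave nothing for pairs of other columns. *)
have meet1 j j' : j != p -> j' != p -> j != j' -> meet j j' = 1.
  move=> jp j'p jj'; apply/eqP.
  have := @excess_pair j p j'.
  rewrite [p == j]eq_sym [j' == j]eq_sym [p == j']eq_sym jp j'p jj' => /(_ isT isT isT).
  by have := meet12 jj'; rewrite [meet j p]meetC meetp; have := weight12 j jp; lia.
have m_light h s : m h s -> ~~ q s.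
  by move=> mhs; have := one_row s; rewrite (bigD1 h) //= mhs; case: (q s).
pose u h j : nat := 1 - \sum_s m h s * b s j.
have uE h j : u h j + \sum_s m h s * b s j = 1.
  by rewrite /u subnK // disjoint_columns.
(* A column counted by u contains no symbol missing from the row h. *)
have u_free h j s : u h j * (m h s * b s j) = 0.
  have := uE h j; rewrite (bigD1 s) //=.
  by case: (m h s * b s j) (u h j) => [|[|x]] [|[|y]] //; lia.
have deg9 s : \sum_(j | j != p) b s j = 3.
  by have := degree s; rewrite (bigD1 p) //= heavy_p; case: (q s) => /=; lia.
have sum_u h : \sum_(j | j != p) u h j = 3.
  have : \sum_(j | j != p) (u h j + \sum_s m h s * b s j) = 9.
    by rewrite -card9; apply: eq_bigr => j _; rewrite uE.
  rewrite big_split /= exchange_big /=.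
  under [X in _ + X = _]eq_bigr do rewrite -big_distrr /= deg9.
  by rewrite -big_distrl /= two_symbols; lia.
have sum_u_rows j : j != p -> \sum_h u h j = weight j.
  move=> jp; have : \sum_h (u h j + \sum_s m h s * b s j) = 4.
    by under eq_bigr do rewrite uE; rewrite sum_nat_const card_ord.
  rewrite big_split /= exchange_big /=.
  under [X in _ + X = _]eq_bigr do rewrite -big_distrl /= one_row.
  by have := sum_light j; lia.
pose n h s := \sum_(j | j != p) b s j * u h j.
have overlap9 s s' : s != s' -> \sum_(j | j != p) b s j * b s' j <= 1.
  move=> ne; have -> : \sum_(j | j != p) b s j * b s' j =
      #|[set j | (j != p) && (b s j && b s' j)]|.
    rewrite -sum1_card big_mkcond [RHS]big_mkcond; apply: eq_bigr => j _.
    by rewrite inE mulnb; case: (j != p) => //=; case: (_ && _).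
  rewrite leqNgt; apply/negP => /card_gt1P[j [j' []]].
  rewrite !inE => /andP[jp /andP[b1 b2]] /andP[j'p /andP[b3 b4]] nej.
  by have := meet_ge2 ne b1 b3 b2 b4; rewrite meet1.
have n_gt0 h s : ~~ m h s -> 1 <= n h s.
  move=> mhs; have : \sum_(j | j != p) (b s j * u h j + b s j * \sum_s' m h s' * b s' j) = 3.
    by rewrite -[3](deg9 s); apply: eq_bigr => j _; rewrite -mulnDr uE muln1.
  rewrite big_split /= -/(n h s).
  suff : \sum_(j | j != p) b s j * \sum_s' m h s' * b s' j <= \sum_s' m h s'.
    by rewrite two_symbols; lia.
  under eq_bigr do rewrite big_distrr; rewrite exchange_big /=.
  apply: leq_sum => s' _; case ms': (m h s'); last by rewrite big1 // => j _; rewrite muln0.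
  under eq_bigr do rewrite mul1n; apply: overlap9.
  by apply: contraNneq mhs => ->.
have m_free h s : m h s -> n h s = 0.
  by move=> mhs; apply: big1 => j _; have := u_free h j s; rewrite mhs mul1n mulnC.
have sum_n h : \sum_s n h s = 12.
  rewrite exchange_big /=; under eq_bigr do rewrite -big_distrl /= col_size.
  by rewrite -big_distrr /= sum_u.
have sum_n2 h : \sum_s n h s * n h s = 18.
  transitivity (\sum_(j | j != p) u h j * (3 + 3 * u h j)).
    under eq_bigr do rewrite big_distrlr /=.
    rewrite exchange_big /=; apply: eq_bigr => j jp; rewrite exchange_big /=.
    transitivity (\sum_(j' | j' != p) u h j * (u h j' + (j' == j) * (3 * u h j'))).
      apply: eq_bigr => j' j'p.
      transitivity (u h j * u h j' * meet j j').
        by rewrite big_distrr; apply: eq_bigr => s _ /=; rewrite mulnACA mulnC.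
      have [->|ne] := eqVneq j j'; last by rewrite meet1 // muln1 mul0n addn0.
      have -> : meet j' j' = 4.
        by rewrite -(col_size j'); apply: eq_bigr => s _; case: (b s j').
      by rewrite -mulnA; congr (_ * _); lia.
    rewrite -big_distrr /= big_split /= sum_u; congr (_ * (_ + _)).
    rewrite (bigD1 j) //= eqxx mul1n big1 ?addn0 // => j' /andP[_ /negbTE ->].
    by rewrite mul0n.
  under eq_bigr do rewrite mulnDr; rewrite big_split /= -big_distrl /= sum_u.
  suff -> : \sum_(j | j != p) u h j * (3 * u h j) = \sum_(j | j != p) u h j * 3.
    by rewrite -big_distrl /= sum_u.
  by apply: eq_bigr => j _; have := uE h j; case: (u h j) => [|[|k]] //; lia.
have heavy6 h : 6 <= \sum_s q s * n h s.
  have [s n3] : exists s, 3 <= n h s.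
    apply/existsP; apply: contraT => /existsPn small.
    have : \sum_s (n h s * n h s + 2) = \sum_s (3 * n h s + 2 * m h s).
      apply: eq_bigr => s _; case mhs: (m h s); first by rewrite m_free.
      have := n_gt0 h s; rewrite mhs => /(_ isT).
      by have := small s; case: (n h s) => [|[|[|k]]].
    rewrite big_split [RHS]big_split /= sum_n2.
    have -> : \sum_s 3 * n h s = 36 by rewrite -big_distrr /= sum_n.
    have -> : \sum_s 2 * m h s = 4 by rewrite -big_distrr /= two_symbols.
    have -> : \sum_(s : V) 2 = 24; last by [].
    have -> : 24 = \sum_s (q s + ~~ q s) * 2.
      by rewrite -big_distrl big_split /= heavy4 light8.
    by apply: eq_bigr => s _; case: (q s).
  have cover j : j != p -> 0 < u h j -> b s j.
    move=> jp uj; apply: contraT => bsj.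
    have : \sum_(j | j != p) (b s j * u h j + ~~ b s j * u h j) = 3.
      by rewrite -[3](sum_u h); apply: eq_bigr => k _; case: (b s k); lia.
    rewrite big_split /= -/(n h s).
    have : 0 < \sum_(j | j != p) ~~ b s j * u h j.
      by rewrite (bigD1 j) //= bsj mul1n ltn_addr.
    lia.
  have mhs : ~~ m h s by apply: contraTN n3 => /m_free ->.
  have qs : q s.
    apply: contraT => qs.
    have [h' mh's] : exists h', m h' s.
      apply/existsP; apply: contraT => /existsPn none.
      have := one_row s; rewrite qs big1 // => k _; have := none k.
      by case: (m k s).
    have [s' /andP[s's mh's']] : exists s', (s' != s) && m h' s'.
      apply/existsP; apply: contraT => /existsPn none.
      have := two_symbols h'; rewrite (bigD1 s) //= mh's big1 // => k ks.
      by have := none k; rewrite ks; case: (m h' k).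
    have mhs' : ~~ m h s'.
      apply: contraT => /negbNE mhs'; have hh' : h != h' by apply: contraNneq mhs => ->.
      have := one_row s'; rewrite (bigD1 h) // (bigD1 h') 1?eq_sym //= mhs' mh's'.
      by case: (q s'); lia.
    have := n_gt0 h s' mhs'; rewrite /n lt0n sum_nat_eq0 => /forallPn[j].
    rewrite negb_imply => /andP[jp]; rewrite muln_eq0 negb_or -lt0n => /andP[bs'j].
    rewrite -lt0n => /(cover j jp) bsj; rewrite lt0b in bs'j.
    have := disjoint_columns h' j; rewrite (bigD1 s) // (bigD1 s') //=.
    by rewrite mh's mh's' bsj bs'j.
  rewrite (bigD1 s) //= qs mul1n; apply: (@leq_trans (3 + 3)) => //; apply: leq_add => //.
  have <- : \sum_(s' | s' != s) q s' = 3.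
    by have := heavy4; rewrite (bigD1 s) //= qs; lia.
  apply: leq_sum => s' _; case qs': (q s') => //; rewrite mul1n n_gt0 //.
  by apply/negP => /m_light; rewrite qs'.
have : \sum_(h < 4) 6 <= \sum_h \sum_s q s * n h s by apply: leq_sum => h _.
rewrite sum_nat_const card_ord.
suff -> : \sum_h \sum_s q s * n h s = 18 by [].
have -> : \sum_h \sum_s q s * n h s = \sum_(j | j != p) weight j * weight j.
  under eq_bigr => h _ do under eq_bigr => s _ do rewrite big_distrr /=.
  under eq_bigr => h _ do rewrite exchange_big /=.
  rewrite exchange_big /=; apply: eq_bigr => j jp.
  rewrite -{2}(sum_u_rows j jp) big_distrr /=; apply: eq_bigr => h _.
  by rewrite big_distrl; apply: eq_bigr => s _ /=; rewrite mulnA.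
have : \sum_(j | j != p) (weight j * weight j + 2 * 1) = \sum_(j | j != p) 3 * weight j.
  apply: eq_bigr => j jp; have := weight12 j jp.
  by case: (weight j) => [|[|[|k]]].
by rewrite big_split /= -!big_distrr /= weights9 card9; lia.
Qed.

Lemma no_incidence_10_12 : False.
Proof.
have [j w3] := exists_weight_ge3.
have := weight_neq3 j; have := weight_neq4 j; have := weight_le4 j.
by case: (weight j) w3 => [|[|[|[|[|k]]]]].
Qed.

End RowClasses.

End TenColumns.

End Incidence.

Section Heavy.
Variables (c v : nat) (A : row_column_design 4 c v).
Hypotheses (binA : binary A) (repA : forall s, 3 <= replication A s <= 4).

Let b s j := s \in col_symbols A j.
Let q s := replication A s == 4.

Lemma column_sum j : \sum_s b s j = 4.
Proof.
rewrite -(card_col_symbols j binA) -sum1_card [RHS]big_mkcond.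
by apply: eq_bigr => s _; rewrite /b; case: (_ \in _).
Qed.

Lemma degree_sum s : \sum_j b s j = 3 + q s.
Proof.
transitivity (replication A s).
  rewrite replication_cols // -sum1_card [RHS]big_mkcond.
  by apply: eq_bigr => j _; rewrite inE /b; case: (_ \in _).
by rewrite /q; have := repA s; case: (replication A s) => [|[|[|[|[|k]]]]].
Qed.

Lemma meet_common j j' : meet b j j' = common_cc A j j'.
Proof.
rewrite /common_cc -sum1_card [RHS]big_mkcond; apply: eq_bigr => s _.
by rewrite inE mulnb /b; case: (_ && _).
Qed.

Lemma sum_light_symbols : \sum_s (~~ q s : nat) + \sum_s (q s : nat) = v.
Proof.
rewrite -big_split /= -[RHS]card_ord -sum1_card.
by apply: eq_bigr => s _; case: (q s).
Qed.

Let m (h : 'I_4) (s : 'I_v) := s \notin row_symbols A h.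

Lemma missing_rows s : \sum_h m h s = ~~ q s.
Proof.
have : \sum_(h < 4) (m h s + (s \in row_symbols A h)) = 4.
  rewrite (eq_bigr (fun=> 1)) ?sum_nat_const ?card_ord // => h _.
  by rewrite /m; case: (_ \in _).
rewrite big_split /=; have -> : \sum_h (s \in row_symbols A h) = replication A s.
  rewrite replication_rows // -sum1_card [RHS]big_mkcond.
  by apply: eq_bigr => h _; rewrite inE; case: (_ \in _).
rewrite /q; have := repA s; case: (replication A s) => [|[|[|[|[|k]]]]] //=; lia.
Qed.

Lemma missing_symbols h : \sum_s m h s + c = v.
Proof.
rewrite -[X in _ + X](card_row_symbols h binA) -sum1_card [X in _ + X = _]big_mkcond.
rewrite -big_split /= -[RHS]card_ord -sum1_card; apply: eq_bigr => s _.
by rewrite /m; case: (_ \in _).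
Qed.

Lemma missing_common h j : \sum_s m h s * b s j + common_rc A h j = 4.
Proof.
apply: etrans (column_sum j); rewrite /common_rc -sum1_card [X in _ + X = _]big_mkcond -big_split.
by apply: eq_bigr => s _; rewrite inE /m /b /=; do 2!case: (_ \in _).
Qed.

End Heavy.

Lemma no_10_12 (A : row_column_design 4 10 12) : ~ near_triple_array A.
Proof.
move=> nta; have binA : binary A by case: nta.
have repA := replication_range (k := 3) nta isT.
have := sum_sqr_replication repA.
have [_ _ ccA rcA] := near_triple_array_bounds nta.
move: (\sum_s _) ccA rcA => S ccA rcA /= SE.
have {SE} SE : S = 136 by lia.
have {}ccA j j' : j != j' -> 1 <= common_cc A j j' <= 2 by move=> /ccA; lia.
have {}rcA i j : 3 <= common_rc A i j by have := rcA i j; lia.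
have heavy4 : \sum_s (replication A s == 4 : nat) = 4.
  by have := sum_heavy repA; move: (\sum_s _) => h; lia.
have light8 : \sum_s (replication A s != 4 : nat) = 8.
  by have := sum_light_symbols A; rewrite heavy4; move: (\sum_s _) => h; lia.
have [sums degs] := (column_sum binA, degree_sum binA repA).
apply: (no_incidence_10_12 sums degs _ _ _ _ (missing_rows binA repA)).
- by rewrite card_ord.
- exact: heavy4.
- exact: light8.
- by move=> j j' ne; rewrite meet_common ccA.
- by move=> h; apply/eqP; rewrite -(eqn_add2r 10) (missing_symbols binA).
- move=> h j; rewrite -(leq_add2r (common_rc A h j)) (missing_common binA).
  by have := rcA h j; lia.
Qed.

Lemma no_11_13 (A : row_column_design 4 11 13) : ~ near_triple_array A.
Proof.
move=> nta; have binA : binary A by case: nta.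
have repA := replication_range (k := 3) nta isT.
have := sum_sqr_replication repA.
have [_ _ ccA _] := near_triple_array_bounds nta.
move: (\sum_s _) ccA => S ccA /= SE.
have {SE} SE : S = 152 by lia.
have {}ccA j j' : j != j' -> common_cc A j j' <= 1 by move=> /ccA; lia.
have heavy5 : \sum_s (replication A s == 4 : nat) = 5.
  by have := sum_heavy repA; move: (\sum_s _) => h; lia.
have light8 : \sum_s (replication A s != 4 : nat) = 8.
  by have := sum_light_symbols A; rewrite heavy5; move: (\sum_s _) => h; lia.
apply: (no_incidence_11_13 (column_sum binA) (degree_sum binA repA)).
- by rewrite card_ord.
- exact: heavy5.
- exact: light8.
- by move=> j j' ne; rewrite meet_common ccA.
Qed.

(** * The theorem *)

Theorem theorem1p5 (c v : nat) (hc : 4 <= c) (hv : 0 < v) :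
  (exists A : row_column_design 4 c v, near_triple_array A) <->
  c <= v /\
  (c, v) \notin [:: (4, 9); (5, 7); (5, 10); (6, 8); (7, 9); (10, 12); (11, 13)].
Proof.
split=> [[A nta]|[cv]]; last exact: existence.
have binA : binary A by case: nta.
split.
  rewrite -(card_row_symbols ord0 binA) -[X in _ <= X]card_ord; exact: max_card.
rewrite !inE; apply/negP.
by move=> /orP[|/orP[|/orP[|/orP[|/orP[|/orP[]]]]]] /eqP[? ?]; subst c v;
  [exact: no_4_9 nta|exact: no_5_7 nta|exact: no_5_10 nta|exact: no_6_8 nta
  |exact: no_7_9 nta|exact: no_10_12 nta|exact: no_11_13 nta].
Qed.
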